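(* Let $\mu_{\boldsymbol p}$ be a Gatzouras--Lalley measure with separation of principal projections, where $\boldsymbol p\in\mathcal P$ is strictly positive, and let $q\in\mathbb R$. Then $$\vartheta_{\boldsymbol p}(q)=\min_{\boldsymbol w\in\mathcal P}\{q\,u_{\boldsymbol p}(\boldsymbol w)-v(\boldsymbol w)\}=\min_{\boldsymbol v\in\eta(\mathcal P)}\Bigl\{\frac{q\,H(\boldsymbol v,\eta(\boldsymbol p))-H(\boldsymbol v)}{\chi_1(\boldsymbol v)}+T_{\boldsymbol p}(\boldsymbol v,q)\Bigr\}.$$
   Context: **Gatzouras--Lalley IFS.** Let $\mathcal I$ be a finite index set with $\#\mathcal I\ge 2$. For $i\in\mathcal I$, $j\in\{1,2\}$ let $\beta_{i,j}\in(0,1)$ and $d_{i,j}\in\mathbb R$, and set $T_i(x_1,x_2)=(\beta_{i,1}x_1+d_{i,1},\beta_{i,2}x_2+d_{i,2})$ and $S_i(x)=\beta_{i,1}x+d_{i,1}$. Assume $T_i((0,1)^2)\subset(0,1)^2$ for all $i$. Write $i\sim j$ if $S_i=S_j$; let $\eta(\mathcal I)$ be the set of equivalence classes (the ''columns'') and $\eta:\mathcal I\to\eta(\mathcal I)$ the quotient map; $S_\ell$ and $\beta_{\ell,1}$ are well defined for $\ell\in\eta(\mathcal I)$. The IFS is Gatzouras--Lalley if (i) $\beta_{i,1}>\beta_{i,2}$ for all $i$; (ii) $T_i((0,1)^2)\cap T_j((0,1)^2)=\varnothing$ for $i\ne j$ in $\mathcal I$; (iii) $S_\ell((0,1))\cap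 S_{m}((0,1))=\varnothing$ for $\ell\ne m$ in $\eta(\mathcal I)$. Let $\Lambda$ be the unique non-empty compact set with $\Lambda=\bigcup_iT_i(\Lambda)$ and let $\eta(\Lambda)$ be its projection to the first coordinate. The IFS has *separation of principal projections* if $T_i(\Lambda)\cap T_j(\Lambda)=\varnothing$ for $i\neq j$ in $\mathcal I$ and $S_\ell(\eta(\Lambda))\cap S_m(\eta(\Lambda))=\varnothing$ for $\ell\ne m$ in $\eta(\mathcal I)$. **Measures.** $\mathcal P$ is the simplex of probability vectors on $\mathcal I$, $\eta(\mathcal P)$ the simplex of probability vectors on $\eta(\mathcal I)$, and $\eta:\mathcal P\to\eta(\mathcal P)$ is $\eta(\boldsymbol w)_\ell=\sum_{i\in\eta^{-1}(\ell)}w_i$. For $\boldsymbol p\in\mathcal P$, $\mu_{\boldsymbol p}$ is the unique Borel probability measure with $\mu_{\boldsymbol p}=\sum_ip_i\,\mu_{\boldsymbol p}\circ T_i^{-1}$, called a Gatzouras--Lalley measure. **Entropy and exponents.** For probability vectors on a common finite set, $H(\boldsymbol w,\boldsymbol q)=\sum_{i:w_i>0}w_i\log(1/q_i)$ and $H(\boldsymbol w)=H(\boldsymbol w,\boldsymbol w)$. $\chi_j(\boldsymbol w)=\sum_iw_i\log(1/\beta_{i,j})$; $\chi_1(\boldsymbol w)$ depends only on $\eta(\boldsymbol w)$, and $\chi_1(\boldsymbol v)=\sum_\ell v_\ell\log(1/\beta_{\ell,1})$ for $\boldsymbol v\in\eta(\mathcal P)$. Define $$v(\boldsymbol w)=\frac{H(\eta(\boldsymbol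 w))}{\chi_1(\eta(\boldsymbol w))}+\frac{H(\boldsymbol w)-H(\eta(\boldsymbol w))}{\chi_2(\boldsymbol w)},\quad u_{\boldsymbol p}(\boldsymbol w)=\frac{H(\eta(\boldsymbol w),\eta(\boldsymbol p))}{\chi_1(\eta(\boldsymbol w))}+\frac{H(\boldsymbol w,\boldsymbol p)-H(\eta(\boldsymbol w),\eta(\boldsymbol p))}{\chi_2(\boldsymbol w)}.$$ **Fibred spectrum.** $T_{\boldsymbol p}(\boldsymbol v,q)$ is the unique real $s$ with $-\sum_{\ell\in\eta(\mathcal I)}v_\ell\log\bigl(\sum_{j\in\eta^{-1}(\ell)}p_j^q\beta_{j,2}^{-s}\bigr)=q\,H(\boldsymbol v,\eta(\boldsymbol p))$. **Fine $L^q$-spectrum.** For a Borel probability measure $\mu$ and $E\subset\operatorname{supp}\mu$, with $B(x,r)$ the closed ball, let $\overline{\mathcal H}^{q,t}_{\mu,\delta}(E)=\inf\{\sum_i\mu(B(x_i,r_i))^qr_i^t: x_i\in E,\ E\subset\bigcup_iB(x_i,r_i),\ r_i\le\delta\}$ (countable covers), $\mathcal H^{q,t}_\mu(E)=\sup_{F\subset E}\sup_{\delta>0}\overline{\mathcal H}^{q,t}_{\mu,\delta}(F)$, and $b_\mu(E,q)=\inf\{t:\mathcal H^{q,t}_\mu(E)<\infty\}$. Then $\vartheta_\mu(q)=-b_\mu(\operatorname{supp}\mu,q)$ and $\vartheta_{\boldsymbol p}=\vartheta_{\mu_{\boldsymbol p}}$. *)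

(* Defs.v *)
From HB Require Import structures.
From mathcomp Require Import all_boot all_order all_algebra generic_quotient.
From mathcomp Require Import all_classical all_reals all_analysis.

Set Implicit Arguments.
Unset Strict Implicit.
Unset Printing Implicit Defensive.

Import Order.TTheory GRing.Theory Num.Theory.
Import numFieldNormedType.Exports.

Local Open Scope classical_set_scope.
Local Open Scope ring_scope.

Record ifs (R : realType) (I : finType) : Type := Ifs {
  beta1 : I -> R;
  beta2 : I -> R;
  d1 : I -> R;
  d2 : I -> R }.

Section Ifs.
Variables (R : realType) (I : finType) (F : ifs R I).

Definition mapT (i : I) (x : R * R) : R * R :=
  (beta1 F i * x.1 + d1 F i, beta2 F i * x.2 + d2 F i).

Definition mapS (i : I) (x : R) : R := beta1 F i * x + d1 F i.

Definition sim : rel I := fun i j => `[< mapS i = mapS j >].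

Lemma sim_refl : reflexive sim.
Proof. by move=> i; apply/asboolP. Qed.

Lemma sim_sym : symmetric sim.
Proof. by move=> i j; apply/asboolP/asboolP => ->. Qed.

Lemma sim_trans : transitive sim.
Proof.
by move=> j i k /asboolP Sij /asboolP Sjk; apply/asboolP; rewrite Sij.
Qed.

Canonical sim_equiv_rel := EquivRel sim sim_refl sim_sym sim_trans.

(* The index set eta(I) of the columns: the equivalence classes of [sim]. *)
Definition column := {eq_quot sim}%qT.
HB.instance Definition _ := Quotient.on column.
HB.instance Definition _ := Finite.copy column (can_type (@reprK _ column)).

Definition eta (i : I) : column := (\pi_column i)%qT.

Lemma eta_eqP i j : reflect (mapS i = mapS j) (eta i == eta j).
Proof.
apply: (iffP eqP) => [/(@eqmodP _ sim_equiv_rel)/asboolP //|Sij].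
by apply/(@eqmodP _ sim_equiv_rel)/asboolP.
Qed.

(* S_l and beta_{l,1} are read off a representative of l; they do not depend
   on its choice, by the two lemmas below. *)
Definition colS (l : column) : R -> R := mapS (repr l).
Definition col_beta1 (l : column) : R := beta1 F (repr l).

Lemma colS_eta i : colS (eta i) = mapS i.
Proof. by apply/eta_eqP/eqP; rewrite /eta reprK. Qed.

Lemma col_beta1_eta i : col_beta1 (eta i) = beta1 F i.
Proof.
have e x : colS (eta i) x = mapS i x by rewrite colS_eta.
have := e 1; have := e 0.
by rewrite /colS /mapS !mulr0 !add0r => -> /addIr; rewrite !mulr1.
Qed.

Definition unit_itv : set R := `]0, 1[.
Definition unit_sq : set (R * R) := unit_itv `*` unit_itv.

Definition gatzouras_lalley : Prop :=
  [/\ (1 < #|I|)%N,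
      forall i, [/\ 0 < beta1 F i < 1, 0 < beta2 F i < 1
                  & mapT i @` unit_sq `<=` unit_sq],
      forall i, beta2 F i < beta1 F i,
      forall i j, i != j -> (mapT i @` unit_sq) `&` (mapT j @` unit_sq) = set0
    & forall l m : column, l != m ->
        (colS l @` unit_itv) `&` (colS m @` unit_itv) = set0].

Definition attractor (L : set (R * R)) : Prop :=
  [/\ L !=set0, compact L & L = \bigcup_i (mapT i @` L)].

Definition separated_principal_projections (L : set (R * R)) : Prop :=
  (forall i j, i != j -> (mapT i @` L) `&` (mapT j @` L) = set0) /\
  (forall l m : column, l != m ->
     (colS l @` (fst @` L)) `&` (colS m @` (fst @` L)) = set0).

End Ifs.

Definition simplex (R : realType) (K : finType) : set (K -> R) :=
  [set w | (forall i, 0 <= w i) /\ \sum_i w i = 1].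

(* No summand with w_i > 0 and q_i = 0 (where [ln] takes a junk value) occurs
   below: the second argument is either strictly positive or [w] itself. *)
Definition cross_entropy (R : realType) (K : finType) (w q : K -> R) : R :=
  \sum_(i | 0 < w i) w i * ln (1 / q i).

Definition entropy (R : realType) (K : finType) (w : K -> R) : R :=
  cross_entropy w w.

Section Vectors.
Variables (R : realType) (I : finType) (F : ifs R I).

Definition eta_vec (w : I -> R) : column F -> R :=
  fun l => \sum_(i | eta F i == l) w i.

Definition chi1 (v : column F -> R) : R :=
  \sum_l v l * ln (1 / col_beta1 l).

Definition chi2 (w : I -> R) : R := \sum_i w i * ln (1 / beta2 F i).

Definition vdim (w : I -> R) : R :=
  entropy (eta_vec w) / chi1 (eta_vec w) +
  (entropy w - entropy (eta_vec w)) / chi2 w.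

Definition udim (p w : I -> R) : R :=
  cross_entropy (eta_vec w) (eta_vec p) / chi1 (eta_vec w) +
  (cross_entropy w p - cross_entropy (eta_vec w) (eta_vec p)) / chi2 w.

Definition fibred_eq (p : I -> R) (v : column F -> R) (q s : R) : Prop :=
  - \sum_l v l * ln (\sum_(j | eta F j == l) p j `^ q * beta2 F j `^ (- s)) =
  q * cross_entropy v (eta_vec p).

(* For v in the simplex and p > 0, [fibred_eq] has exactly one solution s, since
   its left-hand side is strictly monotone in s; [xget] picks that solution. *)
Definition fibred_spectrum (p : I -> R) (v : column F -> R) (q : R) : R :=
  xget 0 [set s | fibred_eq p v q s].

Definition self_affine (p : I -> R) (mu : set (R * R) -> \bar R) : Prop :=
  forall A : set (R * R), measurable A ->
    mu A = (\sum_i (p i)%:E * mu (mapT F i @^-1` A))%E.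

End Vectors.

(* The product sigma-algebra carried by R * R is the Borel sigma-algebra of the
   plane, so [probability (R * R) R] is the type of Borel probability measures. *)
Section FineSpectrum.
Variables (R : realType) (mu : probability (R * R)%type R).

Definition cball (x : R * R) (r : R) : set (R * R) :=
  [set y | Num.sqrt ((y.1 - x.1) ^+ 2 + (y.2 - x.2) ^+ 2) <= r].

Definition supp : set (R * R) :=
  [set x | forall U : set (R * R), open U -> U x -> (0 < mu U)%E].

(* Countable covers are indexed by a subset D of nat, so that finite covers are
   included; balls are centred in E and have positive radius. *)
Definition centred_cover (delta : R) (E : set (R * R)) (D : set nat)
    (x : nat -> R * R) (r : nat -> R) : Prop :=
  (forall n, D n -> E (x n) /\ 0 < r n <= delta) /\
  E `<=` \bigcup_(n in D) cball (x n) (r n).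

Definition Hpre (q t delta : R) (E : set (R * R)) : \bar R :=
  ereal_inf [set s | exists D x r, centred_cover delta E D x r /\
    s = (\esum_(n in D)
          (fine (mu (cball (x n) (r n))) `^ q * r n `^ t)%:E)%E].

Definition Hmeas (q t : R) (E : set (R * R)) : \bar R :=
  ereal_sup [set s | exists A delta,
    [/\ A `<=` E, 0 < delta & s = Hpre q t delta A]].

Definition b_exp (E : set (R * R)) (q : R) : \bar R :=
  ereal_inf [set t%:E | t in [set t : R | (Hmeas q t E < +oo)%E]].

Definition fine_spectrum (q : R) : \bar R := (- b_exp supp q)%E.

End FineSpectrum.

Definition is_minimum (R : realType) (A : set R) (m : R) : Prop :=
  A m /\ lbound A m.

(* Main.v *)
Require Import Defs.
From HB Require Import structures.
From mathcomp Require Import all_boot all_order all_algebra.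
From mathcomp Require Import all_classical all_reals all_analysis.
From mathcomp Require Import ring lra.

(* Points of the attractor are coded by sequences of symbols, and by separation
   a ball is comparable to an approximate square, i.e. to the points that share
   k symbols and n >= k columns with its centre, where the k-th rectangle has
   height, and the n-th width, about the radius.

   Lower bound on b(q) = - theta(q).  Let w minimise q u_p - v.  On the points
   whose Birkhoff averages are w-typical with uniform constants, a ball of
   radius r has p-mass about r^(u_p(w)) and Bernoulli w-mass at most about
   r^(v(w)), so a centred cover of small total weight has small w-mass.  No
   measure on sequences is constructed: the cover and the atypical events are
   supermartingales on finite words, and the method of conditional expectations
   produces a typical point outside of the cover.

   Upper bound.  The weight of the approximate square of a word with symbol
   frequencies w up to k and column frequencies v up to n is its mass for the
   Bernoulli law with fibres w and columns v, times r raised to a power that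
   depends only on (w, v).  For a gauge exponent above the claimed value of
   b(q), this power is positive as soon as the column term evaluated at v
   exceeds the one at eta(w) by at most e.  Since the column term is bounded,
   every point has such scales of arbitrarily large level along k, n(k),
   n(n(k)), ..., and these squares form the cover.

   Gibbs' inequality inside each column identifies the two minima. *)

Set Implicit Arguments.
Unset Strict Implicit.
Unset Printing Implicit Defensive.

Import Defs.
Import Order.TTheory GRing.Theory Num.Theory.
Import numFieldNormedType.Exports.

Local Open Scope classical_set_scope.
Local Open Scope ring_scope.

(** * Optimisation over probability vectors *)

Lemma ln_div1 (R : realType) (x : R) : ln (1 / x) = - ln x.
Proof.
rewrite div1r; have [x0|x0] := ltP 0 x; first by rewrite lnV// posrE.
by rewrite !ln0 ?oppr0// invr_le0.
Qed.

Lemma ln_le_subr1 (R : realType) (x : R) : 0 < x -> ln x <= x - 1.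
Proof.
by move=> x0; rewrite -{1}(subrK 1 x) addrC; apply: le_ln1Dx; lra.
Qed.

(** At 0, [- ln x < 1 / x] for [x = Num.sqrt y] and [ln y = 2 * ln x] bound [|y ln y|] by twice the
    square root of [y]; at negative points [ln] is locally 0. *)
Lemma xlnx_continuous (R : realType) : continuous (fun x : R => x * ln x).
Proof.
move=> x; have [x0|x0|->] := ltgtP x 0.
- have xE : \forall y \near x, 0 = y * ln y.
    near=> y; rewrite ln0 ?mulr0//; apply: ltW.
    by near: y; exact: lt_nbhsl.
  rewrite /continuous_at ln0 ?mulr0; last exact: ltW.
  by apply: cvg_trans (near_eq_cvg xE) _; exact: cvg_cst.
- by apply: cvgM; [exact: cvg_id|exact: continuous_ln].
rewrite /continuous_at mul0r; apply/cvgrPdist_lt => e e0.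
have [d [d0 d1 de]] : exists d : R, [/\ 0 < d, d <= 1 & 2 * d <= e].
  exists (Num.min 1 (e / 2)); rewrite lt_min ltr01 divr_gt0//= ge_min lexx.
  by split=> //; rewrite mulrC -ler_pdivlMr// ge_min lexx orbT.
near=> y.
have yd : `|y| < d ^+ 2.
  rewrite -[y]subr0 distrC; near: y.
  have d20 : 0 < d ^+ 2 by rewrite exprn_gt0.
  exact: (@cvgr_dist_lt _ _ _ _ _ id 0 cvg_id (d ^+ 2) d20).
rewrite sub0r normrN; have [y0|y0] := leP y 0; first by rewrite ln0// mulr0 normr0.
rewrite gtr0_norm// in yd.
have sy : 0 < Num.sqrt y by rewrite sqrtr_gt0.
have sqy : Num.sqrt y ^+ 2 = y by rewrite sqr_sqrtr// ltW.
have sd : Num.sqrt y < d by rewrite -(ltr_pXn2r (n:=2))// ?nnegrE ?ltW// sqy.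
have l0 : ln y <= 0.
  by apply: ln_le0; apply: (le_trans (ltW yd)); rewrite expr_le1// ltW.
have := @ln_sublinear R (Num.sqrt y)^-1.
rewrite invr_gt0 => /(_ sy); rewrite lnV ?posrE//.
have -> : ln y = 2 * ln (Num.sqrt y) by rewrite -{1}sqy lnXn// mulr_natl.
move=> h.
have {}h : - ln (Num.sqrt y) * Num.sqrt y < 1 by rewrite -ltr_pdivlMr// div1r.
have l0' : ln (Num.sqrt y) <= 0 by apply: ln_le0; lra.
rewrite ler0_norm; last by rewrite pmulr_rle0//; lra.
apply: lt_le_trans de.
have : y * - ln (Num.sqrt y) < d.
  rewrite -{1}sqy expr2 -mulrA; apply: lt_trans sd.
  by rewrite gtr_pMr// mulrC.
lra.
Unshelve. all: by end_near.
Qed.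

Lemma continuous_at_sum (R : realType) (T : topologicalType) (J : Type)
    (r : seq J) (P : pred J) (f : J -> T -> R) (x : T) :
  (forall j, P j -> {for x, continuous (f j)}) ->
  {for x, continuous (fun y => \sum_(j <- r | P j) f j y)}.
Proof.
move=> fx; elim: r => [|j r ih].
  have -> : (fun y => \sum_(j <- [::] | P j) f j y) = cst 0.
    by apply/funext => y; rewrite big_nil.
  exact: cvg_cst.
have [Pj|Pj] := boolP (P j).
  have -> : (fun y => \sum_(i <- j :: r | P i) f i y) =
            (fun y => f j y + \sum_(i <- r | P i) f i y).
    by apply/funext => y; rewrite big_cons Pj.
  by apply: cvgD => //; exact: fx.
suff -> : (fun y => \sum_(i <- j :: r | P i) f i y) =
          (fun y => \sum_(i <- r | P i) f i y) by [].
by apply/funext => y; rewrite big_cons (negbTE Pj).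
Qed.

Section ContinuousAt.
Variables (R : realType) (T : topologicalType) (x : T).
Implicit Types f g : T -> R.

Lemma continuous_at_cst (c : R) : {for x, continuous (fun=> c : R)}.
Proof. exact: cvg_cst. Qed.

Lemma continuous_atD f g : {for x, continuous f} -> {for x, continuous g} ->
  {for x, continuous (fun y => f y + g y)}.
Proof. by move=> cf cg; apply: cvgD. Qed.

Lemma continuous_atB f g : {for x, continuous f} -> {for x, continuous g} ->
  {for x, continuous (fun y => f y - g y)}.
Proof. by move=> cf cg; apply: cvgB. Qed.

Lemma continuous_atM f g : {for x, continuous f} -> {for x, continuous g} ->
  {for x, continuous (fun y => f y * g y)}.
Proof. by move=> cf cg; apply: cvgM. Qed.

Lemma continuous_atV f : 0 < f x -> {for x, continuous f} ->
  {for x, continuous (fun y => (f y)^-1)}.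
Proof. by move=> fx cf; apply: cvgV => //; rewrite gt_eqF. Qed.

End ContinuousAt.

Definition avg (R : realType) (K : finType) (w f : K -> R) : R :=
  \sum_i w i * f i.

Section Average.
Variables (R : realType) (K : finType).
Implicit Types w f g : K -> R.

Lemma avgB w f g : avg w (fun i => f i - g i) = avg w f - avg w g.
Proof.
by rewrite /avg -sumrB; apply: eq_bigr => i _; rewrite mulrBr.
Qed.

Lemma avgD w f g : avg w (fun i => f i + g i) = avg w f + avg w g.
Proof.
by rewrite /avg -big_split; apply: eq_bigr => i _; rewrite mulrDr.
Qed.

Lemma avgZ w f (c : R) : avg w (fun i => c * f i) = c * avg w f.
Proof. by rewrite /avg mulr_sumr; apply: eq_bigr => i _; rewrite mulrCA. Qed.

Lemma le_avg w f g : (forall i, 0 <= w i) ->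
  (forall i, w i != 0 -> f i <= g i) -> avg w f <= avg w g.
Proof.
move=> w0 fg; apply: ler_sum => i _.
have [->|wi] := eqVneq (w i) 0; first by rewrite !mul0r.
by apply: ler_wpM2l => //; exact: fg.
Qed.

Lemma avg_cst w (c : R) : \sum_i w i = 1 -> avg w (fun=> c) = c.
Proof. by move=> w1; rewrite /avg -mulr_suml w1 mul1r. Qed.

Lemma cross_entropyE w g : (forall i, 0 <= w i) ->
  cross_entropy w g = - avg w (fun i => ln (g i)).
Proof.
move=> w0; rewrite /cross_entropy /avg -sumrN big_mkcond.
apply: eq_bigr => i _; case: ltP => wi; first by rewrite ln_div1 mulrN.
have /eqP -> : w i == 0 by rewrite eq_le wi w0.
by rewrite mul0r oppr0.
Qed.

Lemma simplex_le1 w i : simplex w -> w i <= 1.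
Proof.
move=> [w0 <-]; rewrite (bigD1 i)//= lerDl; exact: sumr_ge0.
Qed.

Lemma avg_gt0 w f : simplex w -> (forall i, 0 < f i) -> 0 < avg w f.
Proof.
move=> [w0 w1] f0; rewrite lt_def sumr_ge0 ?andbT; last first.
  by move=> i _; rewrite mulr_ge0// ltW.
apply/eqP => /psumr_eq0P wf0; have : \sum_i w i = 0.
  apply: big1 => i _; have /eqP := wf0 (fun i _ => mulr_ge0 (w0 i) (ltW (f0 i))) i isT.
  by rewrite mulf_eq0 (gt_eqF (f0 i)) orbF => /eqP.
by rewrite w1 => /eqP; rewrite oner_eq0.
Qed.

End Average.

Section Columns.
Variables (R : realType) (I : finType) (F : ifs R I).
Implicit Types (w p f : I -> R) (v : column F -> R).

(** Birkhoff sums of [lam1] and [lam2] along a code are minus the logarithms of the width and height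
    of the coded rectangle. *)
Definition lam1 (i : I) : R := - ln (beta1 F i).
Definition lam2 (i : I) : R := - ln (beta2 F i).
Definition colmass w (i : I) : R := eta_vec (F := F) w (eta F i).

Lemma avg_eta w (g : column F -> R) :
  avg (eta_vec w) g = avg w (fun i => g (eta F i)).
Proof.
rewrite /avg /eta_vec [RHS](partition_big (eta F) predT)//=.
apply: eq_bigr => l _; rewrite mulr_suml.
by apply: eq_bigr => i /eqP ->.
Qed.

Lemma eta_vec_ge0 w l : (forall i, 0 <= w i) -> 0 <= eta_vec (F := F) w l.
Proof. by move=> w0; exact: sumr_ge0. Qed.

Lemma eta_vec_sum w : \sum_l eta_vec (F := F) w l = \sum_i w i.
Proof. by rewrite /eta_vec [RHS](partition_big (eta F) predT). Qed.

Lemma eta_vec_simplex w : simplex w -> simplex (eta_vec (F := F) w).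
Proof.
move=> [w0 w1]; split; last by rewrite eta_vec_sum.
by move=> l; exact: eta_vec_ge0.
Qed.

Lemma colmass_ge w i : (forall i, 0 <= w i) -> w i <= colmass w i.
Proof.
by move=> w0; rewrite /colmass /eta_vec (bigD1 i)//= lerDl; exact: sumr_ge0.
Qed.

Lemma colmass_gt0 w i : (forall i, 0 <= w i) -> 0 < w i -> 0 < colmass w i.
Proof. by move=> w0 wi; apply: lt_le_trans wi _; exact: colmass_ge. Qed.

Lemma etaK (l : column F) : eta F (repr l) = l.
Proof. by rewrite /eta reprK. Qed.

Lemma chi2E w : chi2 F w = avg w lam2.
Proof. by apply: eq_bigr => i _; rewrite ln_div1. Qed.

Lemma chi1E v : chi1 v = avg v (fun l => - ln (col_beta1 l)).
Proof. by apply: eq_bigr => i _; rewrite ln_div1. Qed.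

Lemma chi1_eta w : chi1 (eta_vec (F := F) w) = avg w lam1.
Proof.
rewrite chi1E avg_eta; apply: eq_bigr => i _.
by rewrite col_beta1_eta.
Qed.

Lemma entropy_eta w : (forall i, 0 <= w i) ->
  entropy (eta_vec (F := F) w) = - avg w (fun i => ln (colmass w i)).
Proof.
move=> w0; rewrite /entropy cross_entropyE ?avg_eta// => l.
exact: eta_vec_ge0.
Qed.

Lemma cross_entropy_eta w p : (forall i, 0 <= w i) ->
  cross_entropy (eta_vec (F := F) w) (eta_vec p) =
  - avg w (fun i => ln (colmass p i)).
Proof.
by move=> w0; rewrite cross_entropyE ?avg_eta// => l; exact: eta_vec_ge0.
Qed.

Definition objective p (q : R) w : R := q * udim F p w - vdim F w.

Lemma objectiveE p q w : (forall i, 0 <= w i) ->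
  objective p q w =
  (avg w (fun i => ln (colmass w i)) - q * avg w (fun i => ln (colmass p i)))
    / avg w lam1 +
  (avg w (fun i => ln (w i)) - avg w (fun i => ln (colmass w i)) -
   q * (avg w (fun i => ln (p i)) - avg w (fun i => ln (colmass p i))))
    / avg w lam2.
Proof.
move=> w0; rewrite /objective /udim /vdim chi1_eta chi2E.
rewrite cross_entropy_eta// entropy_eta// /entropy !cross_entropyE//.
set a := (avg w lam1)^-1; set b := (avg w lam2)^-1.
ring.
Qed.

Hypothesis hF : gatzouras_lalley F.

Lemma lam1_gt0 i : 0 < lam1 i.
Proof. by have [_ /(_ i)[b _ _] _ _ _] := hF; rewrite oppr_gt0 ln_lt0. Qed.

Lemma lam2_gt0 i : 0 < lam2 i.
Proof. by have [_ /(_ i)[_ b _] _ _ _] := hF; rewrite oppr_gt0 ln_lt0. Qed.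

Lemma lam12 i : lam1 i < lam2 i.
Proof.
have [_ /(_ i)[/andP[b _] /andP[c _] _] /(_ i) bc _ _] := hF.
by rewrite ltrN2 ltr_ln ?posrE.
Qed.

(** The simplex is a closed part of a cube of row vectors, hence compact, and the objective is
    continuous on it since its denominators stay positive. *)
Lemma objective_min p q :
  exists2 w, simplex w & forall w', simplex w' ->
    objective p q w <= objective p q w'.
Proof.
pose wof (M : 'rV[R]_#|I|) : I -> R := fun i => M 0 (enum_rank i).
pose A := [set M : 'rV[R]_#|I| | simplex (wof M)].
have wofK w : exists M, wof M = w.
  exists (\row_j w (enum_val j)); apply/funext => i.
  by rewrite /wof mxE enum_rankK.
have cw i (M : 'rV[R]_#|I|) : {for M, continuous (fun M => wof M i)}.
  exact: coord_continuous.
have csum (P : pred I) (M : 'rV[R]_#|I|) :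
    {for M, continuous (fun M => \sum_(i | P i) wof M i)}.
  by apply: continuous_at_sum => i _; exact: cw.
have A0 : A !=set0.
  have [/ltnW /card_gt0P[i0 _] _ _ _ _] := hF.
  have [M MA] := wofK (fun i => (i == i0)%:R); exists M.
  rewrite /A/= MA; split=> [i|]; first by case: eqP.
  by rewrite (bigD1 i0)//= eqxx big1 ?addr0// => i /negbTE ->.
have cA : compact A.
  apply: (@subclosed_compact _ _
    [set v : 'rV[R]_#|I| | forall i, `[0, 1]%classic (v ord0 i)]).
  - have -> : A = \bigcap_i [set M | wof M i \in `[0, 1]] `&`
                 [set M | \sum_i wof M i = 1].
      apply/seteqP; split=> [M MA|M [M01 M1]].
        split=> [i _|]; last by have [] := MA.
        by rewrite /= in_itv/= simplex_le1// andbT; have [] := MA.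
      by split=> // i; have := M01 i Logic.I; rewrite /= in_itv/= => /andP[].
    apply: closedI.
      apply: closed_bigI => i _.
      apply: (@closed_comp _ _ (fun M => wof M i) `[0, 1]%classic) => [M _|].
        exact: cw.
      exact: interval_closed.
    apply: (@closed_comp _ _ (fun M => \sum_i wof M i) [set 1]) => [M _|].
      exact: csum.
    exact: closed_eq.
  - by apply: (@rV_compact R #|I| (fun=> `[0, 1]%classic)) => i; exact: segment_compact.
  - move=> M MA j; have [w0 _] := MA.
    have := simplex_le1 (enum_val j) MA; have := w0 (enum_val j).
    by rewrite /wof enum_valK /= in_itv/= => -> ->.
(* The column entropy is summed over columns, not symbols: each summand is [x * ln x] of a linear
   form, continuous even where a column loses its mass. *)
pose f M := let w := wof M in
  (avg (eta_vec (F := F) w) (fun l => ln (eta_vec w l))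
     - q * avg w (fun i => ln (colmass p i))) / avg w lam1 +
  (avg w (fun i => ln (w i))
     - avg (eta_vec (F := F) w) (fun l => ln (eta_vec w l)) -
   q * (avg w (fun i => ln (p i)) - avg w (fun i => ln (colmass p i))))
    / avg w lam2.
have fE M : A M -> f M = objective p q (wof M).
  by move=> [w0 _]; rewrite objectiveE// /f avg_eta.
have cavg g (M : 'rV[R]_#|I|) : {for M, continuous (fun M => avg (wof M) g)}.
  apply: continuous_at_sum => i _; apply: continuous_atM; first exact: cw.
  exact: continuous_at_cst.
have ceta (M : 'rV[R]_#|I|) : {for M, continuous (fun M =>
    avg (eta_vec (F := F) (wof M)) (fun l => ln (eta_vec (wof M) l)))}.
  apply: continuous_at_sum => l _.
  apply: (@continuous_comp _ _ _ (fun M => eta_vec (wof M) l) (fun x => x * ln x)).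
    exact: csum.
  exact: xlnx_continuous.
have cent (M : 'rV[R]_#|I|) : {for M, continuous (fun M =>
    avg (wof M) (fun i => ln (wof M i)))}.
  apply: continuous_at_sum => i _.
  apply: (@continuous_comp _ _ _ (fun M => wof M i) (fun x => x * ln x)).
    exact: cw.
  exact: xlnx_continuous.
have cf : {within A, continuous f}.
  apply: continuous_in_subspaceT => M /set_mem MA.
  have lam1_avg : 0 < avg (wof M) lam1 by exact: avg_gt0 lam1_gt0.
  have lam2_avg : 0 < avg (wof M) lam2 by exact: avg_gt0 lam2_gt0.
  apply: (@continuous_atD _ _ _ (fun M => _ / _) (fun M => _ / _)).
    apply: continuous_atM; last exact: continuous_atV.
    apply: continuous_atB => //.
    by apply: continuous_atM => //; exact: continuous_at_cst.
  apply: continuous_atM; last exact: continuous_atV.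
  apply: continuous_atB; first exact: continuous_atB.
  by apply: continuous_atM; [exact: continuous_at_cst|exact: continuous_atB].
have [M /set_mem MA Mmin] := compact_EVT_min A0 cA cf.
exists (wof M) => // w' w's; have [M' M'E] := wofK w'.
have M'A : A M' by rewrite /A/= M'E.
by rewrite -M'E -!fE//; apply: Mmin; rewrite inE.
Qed.

End Columns.

Lemma finite_lower_bound (R : realType) (K : finType) (f : K -> R) :
  (forall i, 0 < f i) -> exists2 c : R, 0 < c & forall i, c <= f i.
Proof.
move=> f0; exists (\big[Num.min/1]_i f i).
  by elim/big_ind : _ => // x y x0 y0; rewrite lt_min x0.
by move=> i; exact: bigmin_le.
Qed.

Lemma finite_upper_bound (R : realType) (K : finType) (f : K -> R) :
  exists2 c : R, 0 < c & forall i, `|f i| <= c.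
Proof.
exists (\big[Num.max/1]_i `|f i|).
  by elim/big_rec : _ => // i x _ x0; rewrite lt_max x0 orbT.
by move=> i; exact: le_bigmax.
Qed.

(** * The fibred spectrum and Gibbs vectors *)

Section Fibred.
Variables (R : realType) (I : finType) (F : ifs R I).
Hypothesis hF : gatzouras_lalley F.
Variables (p : I -> R) (q : R).
Hypothesis p0 : forall i, 0 < p i.
Implicit Types (w : I -> R) (v : column F -> R).

Let ker (s : R) (i : I) : R := p i `^ q * expR (s * lam2 F i).
Let Z (s : R) (l : column F) : R := \sum_(j | eta F j == l) ker s j.

Let ker_gt0 s i : 0 < ker s i.
Proof. by rewrite mulr_gt0 ?powR_gt0// expR_gt0. Qed.

Let ln_ker s i : ln (ker s i) = q * ln (p i) + s * lam2 F i.
Proof. by rewrite lnM ?posrE ?powR_gt0 ?expR_gt0// ln_powR expRK. Qed.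

Let ker_le_Z s i : ker s i <= Z s (eta F i).
Proof.
rewrite /Z (bigD1 i)//= lerDl; apply: sumr_ge0 => j _; exact: ltW.
Qed.

Let Z_gt0 s l : 0 < Z s l.
Proof. by rewrite -(etaK l); apply: lt_le_trans (ker_le_Z s _). Qed.

Let fibred_eqE v s : fibred_eq p v q s <->
  avg v (fun l => ln (Z s l)) = - (q * cross_entropy v (eta_vec p)).
Proof.
have -> : avg v (fun l => ln (Z s l)) =
    \sum_l v l * ln (\sum_(j | eta F j == l) p j `^ q * beta2 F j `^ (- s)).
  apply: eq_bigr => l _; congr (_ * ln _); apply: eq_bigr => j _.
  have [_ /(_ j)[_ /andP[b0 _] _] _ _ _] := hF.
  by rewrite /ker /lam2 mulrN -mulNr [in RHS]/powR (gt_eqF b0).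
rewrite /fibred_eq; split=> [<-|->]; by rewrite opprK.
Qed.

(** Intermediate value theorem: the average of [ln Z] lies above an affine function of positive
    slope for all [s], and below another one for [s <= 0]. *)
Lemma fibred_eq_ex v : simplex v -> exists s, fibred_eq p v q s.
Proof.
move=> vs; have [v0 v1] := vs.
pose phi s := avg v (fun l => ln (Z s l)).
have cphi : continuous phi.
  move=> s; apply: continuous_at_sum => l _.
  apply: continuous_atM; first exact: continuous_at_cst.
  apply: (@continuous_comp _ _ _ (fun s => Z s l) (@ln R)); last first.
    exact: continuous_ln.
  apply: continuous_at_sum => i _.
  apply: continuous_atM; first exact: continuous_at_cst.
  apply: (@continuous_comp R R R (fun s : R => s * lam2 F i) (@expR R) s).
    by apply: continuous_atM; [exact: cvg_id|exact: continuous_at_cst].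
  exact: continuous_expR.
pose A := avg v (fun l => q * ln (p (repr l))).
pose B := avg v (fun l => lam2 F (repr l)).
have B0 : 0 < B by apply: avg_gt0 => // l; exact: lam2_gt0.
(* Only the representative symbol of each column is kept. *)
have lo s : A + s * B <= phi s.
  rewrite /A /B -avgZ -avgD; apply: le_avg => // l _; rewrite -ln_ker.
  rewrite ler_ln ?posrE//; have := ker_le_Z s (repr l).
  by rewrite etaK.
have [b b0 bl] := finite_lower_bound (lam2_gt0 hF).
pose C := \sum_i p i `^ q.
have C0 : 0 < C.
  have [/ltnW /card_gt0P[i0 _] _ _ _ _] := hF.
  rewrite /C (bigD1 i0)//= ltr_wpDr ?powR_gt0//.
  by apply: sumr_ge0 => i _; exact: powR_ge0.
(* For [s <= 0] each exponential is at most [expR (s * b)], and the column sum is enlarged to all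
   symbols. *)
have hi s : s <= 0 -> phi s <= ln C + s * b.
  move=> s0; rewrite -[leRHS](avg_cst _ v1); apply: le_avg => // l _.
  rewrite -[s * b]expRK -lnM ?posrE ?expR_gt0// ler_ln ?posrE ?mulr_gt0 ?expR_gt0//.
  rewrite /C mulr_suml [leRHS](bigID (fun j => eta F j == l))/= -[leLHS]addr0.
  apply: lerD; last first.
    by apply: sumr_ge0 => i _; rewrite mulr_ge0 ?powR_ge0 ?expR_ge0.
  apply: ler_sum => i _; rewrite ler_wpM2l ?powR_ge0// ler_expR.
  exact: ler_wnM2l.
pose c := - (q * cross_entropy v (eta_vec p)).
pose M := `|c - A| / B; pose N := - (`|c - ln C| / b).
have M0 : 0 <= M by rewrite divr_ge0// ltW.
have N0 : N <= 0 by rewrite oppr_le0 divr_ge0// ltW.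
have phiM : c <= phi M.
  apply: le_trans (lo M); rewrite /M divfK ?gt_eqF//.
  by have := ler_norm (c - A); lra.
have phiN : phi N <= c.
  apply: le_trans (hi _ N0) _; rewrite /N mulNr divfK ?gt_eqF//.
  by have := ler_norm (- (c - ln C)); rewrite normrN; lra.
have [s _ sE] := @IVT R phi N M c (le_trans N0 M0) (continuous_subspaceT cphi)
  ltac:(by rewrite ge_min le_max phiM phiN orbT).
by exists s; apply/fibred_eqE.
Qed.

(* Gibbs' inequality inside each column, against the weights [ker s]. *)
Lemma fibred_le_objective w s : simplex w -> fibred_eq p (eta_vec (F := F) w) q s ->
  (q * cross_entropy (eta_vec (F := F) w) (eta_vec p) - entropy (eta_vec (F := F) w))
    / chi1 (eta_vec (F := F) w) + s <= objective F p q w.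
Proof.
move=> ws; have [w0 w1] := ws; move=> /fibred_eqE.
rewrite avg_eta cross_entropy_eta// entropy_eta// chi1_eta objectiveE// => sE.
apply: lerD; first by rewrite le_eqVlt; apply/orP; left; apply/eqP; congr (_ / _); ring.
rewrite ler_pdivlMr; last by apply: avg_gt0 => //; exact: lam2_gt0.
have : avg w (fun i => (q * ln (p i) + s * lam2 F i) + ln (colmass F w i)
         - ln (Z s (eta F i)) - ln (w i)) <= 0; last first.
  rewrite !(avgB, avgD, avgZ); lra.
(* [x] keeps the column masses of [w] and splits them proportionally to [ker s]. Both vectors have
   total mass 1, so a termwise bound of [w * ln (x / w)] by [x - w] suffices. *)
pose x i := ker s i * colmass F w i / Z s (eta F i).
have -> : 0 = \sum_i (x i - w i).
  rewrite sumrB w1 /x (partition_big (eta F) predT)//=.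
  rewrite (eq_bigr (eta_vec w)) ?eta_vec_sum ?w1 ?subrr// => l _.
  rewrite (eq_bigr (fun i => ker s i * (eta_vec w l / Z s l))); last first.
    by move=> i /eqP <-; rewrite mulrA.
  by rewrite -mulr_suml -/(Z s l) mulrCA divff ?mulr1// gt_eqF.
apply: ler_sum => i _; have [wi|wi] := eqVneq (w i) 0.
  rewrite wi mul0r subr0; apply: divr_ge0; last exact: ltW.
  by apply: mulr_ge0; [exact: ltW|exact: eta_vec_ge0].
have {}wi : 0 < w i by rewrite lt_def wi w0.
have ci : 0 < colmass F w i by exact: colmass_gt0.
have xi : 0 < x i by rewrite divr_gt0// mulr_gt0.
have -> : q * ln (p i) + s * lam2 F i + ln (colmass F w i)
    - ln (Z s (eta F i)) - ln (w i) = ln (x i / w i).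
  have kc : 0 < ker s i * colmass F w i by exact: mulr_gt0.
  by rewrite ln_div ?posrE// /x ln_div ?posrE// lnM ?posrE// ln_ker.
apply: (@le_trans _ _ (w i * (x i / w i - 1))).
  by apply: ler_wpM2l => //; apply: ln_le_subr1; rewrite divr_gt0.
by rewrite mulrBr mulr1 mulrCA divff ?mulr1// gt_eqF.
Qed.

(** Equality case of Gibbs' inequality: split each column mass of [v] proportionally to [ker s]. *)
Lemma objective_fibred_ex v s : simplex v -> fibred_eq p v q s ->
  exists2 w, simplex w & objective F p q w =
    (q * cross_entropy v (eta_vec p) - entropy v) / chi1 v + s.
Proof.
move=> [v0 v1] sE.
pose w i := ker s i * v (eta F i) / Z s (eta F i).
have w0 i : 0 <= w i.
  by apply: divr_ge0; [apply: mulr_ge0|]; rewrite // ltW.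
have wv : eta_vec w = v.
  apply/funext => l; rewrite /eta_vec.
  rewrite (eq_bigr (fun i => ker s i * (v l / Z s l))); last first.
    by move=> i /eqP <-; rewrite mulrA.
  by rewrite -mulr_suml -/(Z s l) mulrCA divff ?mulr1// gt_eqF.
have ws : simplex w by split=> //; rewrite -(eta_vec_sum F) wv.
exists w => //; move: sE => /fibred_eqE; rewrite -wv.
rewrite avg_eta cross_entropy_eta// entropy_eta// chi1_eta objectiveE// => sE.
congr (_ + _); first by congr (_ / _); ring.
have wE : avg w (fun i => ln (w i)) = avg w (fun i => (q * ln (p i) + s * lam2 F i)
    + ln (colmass F w i) - ln (Z s (eta F i))).
  apply: eq_bigr => i _; have [->|wi] := eqVneq (w i) 0; first by rewrite !mul0r.
  have vi : 0 < v (eta F i).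
    rewrite lt_def v0 andbT; apply: contra_neq wi => vi.
    by rewrite /w vi mulr0 mul0r.
  have kv : 0 < ker s i * v (eta F i) by exact: mulr_gt0.
  by rewrite /colmass wv {2}/w ln_div ?posrE// lnM ?posrE// ln_ker.
have l0 : 0 < avg w (lam2 F) by apply: avg_gt0 => //; exact: lam2_gt0.
apply: (mulIf (lt0r_neq0 l0)); rewrite divfK ?gt_eqF//.
move: wE; rewrite !(avgB, avgD, avgZ); lra.
Qed.

(** Each value on the column side is a value of [objective], hence at least [m]; at the column
    vector of a minimiser it is at most [m]. *)
Lemma fibred_min m : is_minimum [set objective F p q w | w in @simplex R I] m ->
  is_minimum [set (q * cross_entropy v (eta_vec p) - entropy v) / chi1 v
               + fibred_spectrum p v q | v in @simplex R (column F)] m.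
Proof.
move=> [[w ws wm] mlow].
have fibE v : simplex v -> fibred_eq p v q (fibred_spectrum p v q).
  by move=> vs; have [s sE] := fibred_eq_ex vs; exact: (xgetI _ sE).
have low v : simplex v -> m <= (q * cross_entropy v (eta_vec p) - entropy v)
    / chi1 v + fibred_spectrum p v q.
  move=> vs; have [w' w's <-] := objective_fibred_ex vs (fibE _ vs).
  by apply: mlow; exists w'.
split; last by move=> _ [v vs <-]; exact: low.
have ews := eta_vec_simplex F ws.
exists (eta_vec w) => //; apply/eqP; rewrite eq_le low// andbT -wm.
exact: fibred_le_objective (fibE _ ews).
Qed.
End Fibred.

(** * Supermartingales on words *)

Section Selection.
Variables (R : realType) (I : finType) (w : I -> R).
Hypothesis ws : simplex w.
Implicit Types (A : seq (pred I)) (u : seq I).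

(* Method of conditional expectations: it replaces a measure on I^N by
   countably many supermartingales of small total mass. *)
Lemma supermartingale_selection (g : nat -> seq I -> R) (c : R) :
  (forall n u, 0 <= g n u) ->
  (forall n u, \sum_a w a * g n (rcons u a) <= g n u) ->
  (forall N, \sum_(n < N) g n [::] <= c) ->
  exists s : nat -> I, forall k N, \sum_(n < N) g n (mkseq s k) <= c.
Proof.
move=> g0 gS gc; have [w0 w1] := ws.
have step u : exists a, (forall N, \sum_(n < N) g n u <= c) ->
    forall N, \sum_(n < N) g n (rcons u a) <= c.
  apply/not_existsP => h.
  have uc : forall N, \sum_(n < N) g n u <= c.
    apply: contrapT => uc.
    have [a _|I0] := pickP (fun _ : I => true).
      by apply: (h a) => /uc.
    by move/eqP: w1; rewrite big_pred0// eq_sym oner_eq0.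
  (* If every letter violated the bound at some [N], then by nonnegativity all would violate it at
     the largest such [N], and averaging over letters would contradict the supermartingale
     inequality. *)
  have /choice[N cN] : forall a, exists N, c < \sum_(n < N) g n (rcons u a).
    move=> a; apply/not_existsP => h'; apply: (h a) => _ N.
    by rewrite leNgt; apply/negP => /h'.
  pose M := \max_a N a.
  have cM a : 0 < \sum_(n < M) g n (rcons u a) - c.
    rewrite subr_gt0; apply: lt_le_trans (cN a) _.
    rewrite -!(big_mkord xpredT (fun n => g n (rcons u a))).
    rewrite [leRHS](big_cat_nat _ (n := N a))//= ?lerDl ?sumr_ge0//.
    exact: leq_bigmax.
  have := avg_gt0 ws cM; rewrite avgB avg_cst// subr_gt0 ltNge => /negP; apply.
  apply: le_trans (uc M); rewrite /avg.
  under eq_bigr do rewrite mulr_sumr.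
  by rewrite exchange_big/=; apply: ler_sum => n _; exact: gS.
have [next nextP] := choice step.
pose W := fix W k := if k is k'.+1 then rcons (W k') (next (W k')) else [::].
have WE k : mkseq (fun j => next (W j)) k = W k.
  by elim: k => // k ih; rewrite mkseqS ih.
by exists (fun j => next (W j)) => k; rewrite WE; elim: k => //= k /nextP.
Qed.

(* Conditional probability, given the prefix [u], that the first symbols of an
   i.i.d. sequence with law [w] satisfy the predicates in [A]. *)
Fixpoint cond_mass (A : seq (pred I)) (u : seq I) : R :=
  match A, u with
  | [::], _ => 1
  | X :: A', [::] => (\sum_(i | X i) w i) * cond_mass A' [::]
  | X :: A', a :: u' => if X a then cond_mass A' u' else 0
  end.

Lemma cond_mass_ge0 A u : 0 <= cond_mass A u.
Proof.
have [w0 _] := ws; elim: A u => [|X A ih] [|a u]//=; last by case: ifP.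
by rewrite mulr_ge0// sumr_ge0.
Qed.

Lemma cond_mass_martingale A u :
  \sum_a w a * cond_mass A (rcons u a) = cond_mass A u.
Proof.
have [w0 w1] := ws; elim: A u => [|X A ih] [|b u]/=.
- by under eq_bigr do rewrite mulr1.
- by under eq_bigr do rewrite mulr1.
- rewrite mulr_suml [RHS]big_mkcond; apply: eq_bigr => a _.
  by case: ifP => _; rewrite ?mulr0.
- by case: (X b); [exact: ih|rewrite big1// => a _; rewrite mulr0].
Qed.

Lemma cond_mass_nil A : cond_mass A [::] = \prod_(X <- A) \sum_(i | X i) w i.
Proof. by elim: A => [|X A ih]; rewrite ?big_nil// big_cons /= ih. Qed.

(** Used in contrapositive form: a sequence along which this martingale stays below 1 avoids the
    cylinder of [A]. *)
Lemma cond_mass_match A (s : nat -> I) :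
  (forall j, (j < size A)%N -> nth (pred0 : pred I) A j (s j)) ->
  cond_mass A (mkseq s (size A)) = 1.
Proof.
elim: A s => [|X A ih] s //= sA.
have /= -> := sA 0%N isT.
rewrite -[iota 1 _]/(iota (1 + 0) _) iotaDl -map_comp.
by apply: (ih (fun j => s j.+1)) => j jA; exact: (sA j.+1).
Qed.

(** Follows from [1 - x <= expR (- x)], since [(1 - x) * (1 + x + 2 * x ^+ 2) = 1 + x ^+ 2 * (1 - 2
    * x)]. *)
Lemma expR_quadratic_ub (x : R) : x <= 1 / 2 -> expR x <= 1 + x + 2 * x ^+ 2.
Proof.
move=> x2; have x1 : 0 < 1 - x by lra.
have : expR x <= (1 - x)^-1.
  rewrite -[expR x]invrK -expRN lef_pV2 ?posrE ?expR_gt0//.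
  by have := expR_ge1Dx (- x).
move/le_trans; apply; rewrite -[leLHS]mul1r ler_pdivrMr//.
have : 0 <= x ^+ 2 * (1 - 2 * x) by rewrite mulr_ge0 ?sqr_ge0//; lra.
nra.
Qed.

(** Chernoff's argument: [y] has mean [- e], so for small [a] the linear gain [a * e] beats the
    quadratic term. *)
Lemma exponential_supermartingale (f : I -> R) (e : R) : 0 < e ->
  exists2 a : R, 0 < a &
    \sum_i w i * expR (a * (f i - avg w f - e)) <= 1.
Proof.
move=> e0; have [w0 w1] := ws; pose y i := f i - avg w f - e.
have [C C0 yC] := finite_upper_bound y.
(* The first bound makes [expR_quadratic_ub] applicable to [a * y]; the second makes
   [2 * a ^+ 2 * C ^+ 2] at most [a * e]. *)
pose a := Num.min (1 / 2 / C) (e / 2 / C ^+ 2).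
have C20 : 0 < C ^+ 2 by rewrite exprn_gt0.
have a0 : 0 < a by rewrite lt_min !divr_gt0.
have aC : a * C <= 1 / 2 by rewrite -ler_pdivlMr// ge_min lexx.
have aC2 : a * C ^+ 2 <= e / 2 by rewrite -ler_pdivlMr// ge_min lexx orbT.
exists a => //.
apply: (@le_trans _ _ (avg w (fun i => (1 + a * y i) + 2 * (a ^+ 2 * C ^+ 2)))).
  apply: ler_sum => i _; apply: ler_wpM2l => //.
  have := yC i; rewrite ler_norml => /andP[yl yu].
  have ay : a * y i <= 1 / 2.
    by apply: le_trans aC; rewrite ler_pM2l.
  apply: le_trans (expR_quadratic_ub ay) _.
  rewrite lerD2l ler_pM2l// exprMn ler_pM2l ?exprn_gt0//.
  by rewrite -(real_normK (num_real (y i))) lerXn2r ?nnegrE// ltW.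
rewrite !avgD !avg_cst// avgZ /y !avgB !avg_cst// subrr sub0r.
have : a * (a * C ^+ 2) <= a * (e / 2) by rewrite ler_pM2l.
rewrite mulrA -expr2; lra.
Qed.

End Selection.

(** * Coding of the attractor *)

Definition birkhoff (R : realType) (I : finType) (f : I -> R) (s : nat -> I)
  (n : nat) : R := \sum_(j < n) f (s j).

Lemma birkhoffSl (R : realType) (I : finType) (f : I -> R) (s : nat -> I) n :
  birkhoff f s n.+1 = f (s 0%N) + birkhoff f (fun j => s j.+1) n.
Proof. by rewrite /birkhoff big_ord_recl. Qed.

Lemma birkhoffSr (R : realType) (I : finType) (f : I -> R) (s : nat -> I) n :
  birkhoff f s n.+1 = birkhoff f s n + f (s n).
Proof. by rewrite /birkhoff big_ord_recr. Qed.

Lemma compact_closed_separated (R : realType) (T : pseudoMetricType R)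
    (A B : set T) : compact A -> closed B -> A `&` B = set0 ->
  exists2 d : R, 0 < d & forall a b, A a -> B b -> ~ ball a d b.
Proof.
move=> cA cB AB0.
have := (iffLR (compact_near_coveringP A)) cA.
move=> /(_ R (0^'+) (fun d x => forall b, B b -> ~ ball x d b) _).
have h x : A x -> \forall x' \near x & d \near 0^'+, forall b, B b -> ~ ball x' d b.
  move=> Ax.
  have : nbhs x (~` B).
    apply: open_nbhs_nbhs; split; first exact: closed_openC.
    by move=> Bx; have : (A `&` B) x by []; rewrite AB0.
  move/nbhs_ballP => [e /= e0 eB].
  have e20 : 0 < e / 2 by rewrite divr_gt0.
  exists (ball x (e / 2), [set d | d < e / 2]) => /=.
    split; first exact: nbhsx_ballx.
    exact: nbhs_right_lt.
  move=> [x' d] /= [xx' de] b Bb x'b; apply: (eB b) => //.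
  rewrite (splitr e); apply: ball_triangle xx' _.
  exact: le_ball (ltW de) _ x'b.
move=> /(_ h) near0.
have /filter_ex[d [dP d0]] : \forall d \near 0^'+,
    (A `<=` (fun x => forall b, B b -> ~ ball x d b)) /\ (0 < d :> R).
  near=> d; split; first by near: d.
  by near: d; exact: nbhs_right_gt.
by exists d => // a b Aa Bb; exact: dP.
Unshelve. all: by end_near.
Qed.

Lemma finite_min_pos (R : realType) (K : finType) (P : K -> R -> Prop) :
  (forall i d d', d' <= d -> P i d -> P i d') ->
  (forall i, exists2 d, 0 < d & P i d) ->
  exists2 d : R, 0 < d & forall i, P i d.
Proof.
move=> mono ex; have /choice[f fP] : forall i, exists d, 0 < d /\ P i d.
  by move=> i; have [d] := ex i; exists d.
have [c c0 cf] := @finite_lower_bound R K f (fun i => (fP i).1).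
by exists c => // i; apply: mono (cf i) (fP i).2.
Qed.

Lemma mapT_continuous (R : realType) (I : finType) (F : ifs R I) (i : I) :
  continuous (mapT F i).
Proof.
move=> x; have c1 : {for x, continuous (fun y => (mapT F i y).1)}.
  apply: continuous_atD; last exact: continuous_at_cst.
  by apply: continuous_atM; [exact: continuous_at_cst|exact: cvg_fst].
have c2 : {for x, continuous (fun y => (mapT F i y).2)}.
  apply: continuous_atD; last exact: continuous_at_cst.
  by apply: continuous_atM; [exact: continuous_at_cst|exact: cvg_snd].
exact: (cvg_pair c1 c2).
Qed.

Section Coding.
Variables (R : realType) (I : finType) (F : ifs R I) (L : set (R * R)).
Hypothesis hF : gatzouras_lalley F.
Hypothesis hL : attractor F L.
Hypothesis hsep : separated_principal_projections F L.

Let beta1_gt0 i : 0 < beta1 F i.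
Proof. by have [_ /(_ i)[/andP[]]] := hF. Qed.

Let beta2_gt0 i : 0 < beta2 F i.
Proof. by have [_ /(_ i)[_ /andP[]]] := hF. Qed.

Let beta21 i : beta2 F i < beta1 F i.
Proof. by have [_ _ /(_ i)] := hF. Qed.

Let beta1E i : expR (- lam1 F i) = beta1 F i.
Proof. by rewrite opprK lnK ?posrE. Qed.

Let beta2E i : expR (- lam2 F i) = beta2 F i.
Proof. by rewrite opprK lnK ?posrE. Qed.

Lemma mapT_inj i : injective (mapT F i).
Proof.
move=> [x1 x2] [y1 y2] [/addIr/mulfI h1 /addIr/mulfI h2].
by rewrite h1 ?h2// gt_eqF.
Qed.

Lemma attractor_map i x : L x -> L (mapT F i x).
Proof.
have [_ _ LE] := hL => Lx; rewrite LE.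
by exists i => //; exists x.
Qed.

Lemma attractor_preim x : L x -> exists i y, L y /\ x = mapT F i y.
Proof.
have [_ _ {1}->] := hL; move=> [i _ [y Ly <-]].
by exists i, y.
Qed.

Lemma mapT_sep i j x y : L x -> L y -> mapT F i x = mapT F j y -> i = j /\ x = y.
Proof.
move=> Lx Ly xy; have ij : i = j.
  apply/eqP/negP => /negP ij; have := hsep.1 _ _ ij.
  by rewrite -subset0 => /(_ (mapT F i x)); apply; split; [exists x|exists y].
by split=> //; move: xy; rewrite ij => /mapT_inj.
Qed.

Definition coding (c : R * R -> nat -> I) : Prop := forall i x, L x ->
  c (mapT F i x) 0%N = i /\ forall n, c (mapT F i x) n.+1 = c x n.

(** Separation makes the pair of a first symbol and a preimage in [L] unique, so the code is read
    off by iterating the inverse map; [(i0, x)] is a default for points without such a pair. *)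
Lemma coding_ex : exists c, coding c.
Proof.
have [/ltnW /card_gt0P[i0 _] _ _ _ _] := hF.
pose pre x := xget (i0, x) [set z : I * (R * R) | L z.2 /\ mapT F z.1 z.2 = x].
have preE i x : L x -> pre (mapT F i x) = (i, x).
  move=> Lx; apply: xget_unique => //= -[j y]/= [Ly yx].
  by have [-> ->] := mapT_sep Ly Lx yx.
exists (fun x n => (pre (iter n (fun y => (pre y).2) x)).1) => i x Lx.
split=> [|n]; first by rewrite /= preE.
by rewrite iterSr preE.
Qed.

Lemma attractor_bounded : exists2 D : R, 0 < D &
  forall x y, L x -> L y -> `|x.1 - y.1| <= D /\ `|x.2 - y.2| <= D.
Proof.
have [_ cL _] := hL.
have [M [_ ML]] := compact_bounded cL.
pose M' := `|M| + 1.
have MM : M < M' by have := ler_norm M; rewrite /M'; lra.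
exists (M' + M'); first by rewrite addr_gt0// ltr_wpDl.
move=> x y /(ML _ MM); rewrite /= prod_normE ge_max => /andP[x1 x2].
move=> /(ML _ MM); rewrite /= prod_normE ge_max => /andP[y1 y2].
by split; apply: le_trans (ler_normB _ _) _; exact: lerD.
Qed.

(** The finitely many images of [L] are compact and pairwise disjoint, so their distances have a
    positive lower bound. *)
Lemma symbol_gap : exists2 d : R, 0 < d & forall i j x y, L x -> L y -> i != j ->
  `|(mapT F i x).1 - (mapT F j y).1| < d -> `|(mapT F i x).2 - (mapT F j y).2| < d ->
  False.
Proof.
have [L0 cL LE] := hL.
have cT i : compact (mapT F i @` L).
  apply: continuous_compact => //; apply: continuous_subspaceT.
  exact: mapT_continuous.
suff [d d0 dP] : exists2 d : R, 0 < d & forall (ij : I * I) x y, L x -> L y ->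
    ij.1 != ij.2 -> `|(mapT F ij.1 x).1 - (mapT F ij.2 y).1| < d ->
    `|(mapT F ij.1 x).2 - (mapT F ij.2 y).2| < d -> False.
  by exists d => // i j; exact: (dP (i, j)).
apply: finite_min_pos => [[i j] d d' dd' h x y Lx Ly ij h1 h2|].
  by apply: (h x y) => //; exact: lt_le_trans dd'.
move=> [i j]/=; have [<-|ij] := eqVneq i j; first by exists 1.
have [d d0 dP] := compact_closed_separated (cT i)
  (compact_closed (@norm_hausdorff _ _) (cT j)) (hsep.1 _ _ ij).
exists d => // x y Lx Ly _ h1 h2.
apply: (dP (mapT F i x) (mapT F j y)); [by exists x|by exists y|].
by split; rewrite /ball/=.
Qed.

Lemma column_gap : exists2 d : R, 0 < d & forall i j x y, L x -> L y ->
  eta F i != eta F j -> `|(mapT F i x).1 - (mapT F j y).1| < d -> False.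
Proof.
have [L0 cL LE] := hL.
have cT (l : column F) : compact (colS l @` (fst @` L)).
  apply: continuous_compact.
    apply: continuous_subspaceT => x.
    apply: continuous_atD; last exact: continuous_at_cst.
    by apply: continuous_atM; [exact: continuous_at_cst|exact: cvg_id].
  apply: continuous_compact => //; apply: continuous_subspaceT => x.
  exact: cvg_fst.
suff [d d0 dP] : exists2 d : R, 0 < d & forall (ij : column F * column F) x y,
    L x -> L y -> ij.1 != ij.2 -> `|colS ij.1 x.1 - colS ij.2 y.1| < d -> False.
  exists d => // i j x y Lx Ly ij; have := dP (eta F i, eta F j) x y Lx Ly ij.
  by rewrite !colS_eta.
apply: finite_min_pos => [[i j] d d' dd' h x y Lx Ly ij h1|].
  by apply: (h x y) => //; exact: lt_le_trans dd'.
move=> [i j]/=; have [<-|ij] := eqVneq i j; first by exists 1.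
have [d d0 dP] := compact_closed_separated (cT i)
  (compact_closed (@Rhausdorff _) (cT j)) (hsep.2 _ _ ij).
exists d => // x y Lx Ly _ h1.
apply: (dP (colS i x.1) (colS j y.1)) => //.
  by exists x.1 => //; exists x.
by exists y.1 => //; exists y.
Qed.

Section Geometry.
Variables (c : R * R -> nat -> I) (hc : coding c).

Lemma coding_shift i x : L x -> (fun n => c (mapT F i x) n.+1) = c x.
Proof. by move=> Lx; apply/funext => n; rewrite (hc i Lx).2. Qed.

Let mapT1_dist i j x y : eta F i = eta F j ->
  `|(mapT F i x).1 - (mapT F j y).1| = beta1 F i * `|x.1 - y.1|.
Proof.
move=> /eqP/eta_eqP ij; rewrite -[(mapT F j y).1]/(mapS F j y.1) -ij.
by rewrite /mapS/= opprD addrACA subrr addr0 -mulrBr normrM gtr0_norm.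
Qed.

Let mapT2_dist i x y :
  `|(mapT F i x).2 - (mapT F i y).2| = beta2 F i * `|x.2 - y.2|.
Proof.
by rewrite /= opprD addrACA subrr addr0 -mulrBr normrM gtr0_norm.
Qed.

(** Symbols of one column act identically on the first coordinate, so common columns contract it
    even where the symbols differ. *)
Lemma dist1_le D x y n :
  (forall x y, L x -> L y -> `|x.1 - y.1| <= D /\ `|x.2 - y.2| <= D) ->
  L x -> L y -> (forall j, (j < n)%N -> eta F (c x j) = eta F (c y j)) ->
  `|x.1 - y.1| <= D * expR (- birkhoff (lam1 F) (c x) n).
Proof.
move=> hD; elim: n x y => [|n ih] x y Lx Ly xy.
  by rewrite /birkhoff big_ord0 oppr0 expR0 mulr1; case: (hD _ _ Lx Ly).
have [i [x' [Lx' xE]]] := attractor_preim Lx.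
have [j [y' [Ly' yE]]] := attractor_preim Ly.
subst x y; have := xy 0%N isT; rewrite (hc i Lx').1 (hc j Ly').1 => ij.
rewrite mapT1_dist// birkhoffSl coding_shift// (hc i Lx').1 opprD expRD beta1E.
rewrite mulrCA ler_pM2l//; apply: ih => // k kn.
by have := xy k.+1 kn; rewrite (hc i Lx').2 (hc j Ly').2.
Qed.

Lemma dist2_le D x y n :
  (forall x y, L x -> L y -> `|x.1 - y.1| <= D /\ `|x.2 - y.2| <= D) ->
  L x -> L y -> (forall j, (j < n)%N -> c x j = c y j) ->
  `|x.2 - y.2| <= D * expR (- birkhoff (lam2 F) (c x) n).
Proof.
move=> hD; elim: n x y => [|n ih] x y Lx Ly xy.
  by rewrite /birkhoff big_ord0 oppr0 expR0 mulr1; case: (hD _ _ Lx Ly).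
have [i [x' [Lx' xE]]] := attractor_preim Lx.
have [j [y' [Ly' yE]]] := attractor_preim Ly.
subst x y; have := xy 0%N isT; rewrite (hc i Lx').1 (hc j Ly').1 => ij.
subst j; rewrite mapT2_dist// birkhoffSl coding_shift// (hc i Lx').1 opprD expRD.
rewrite beta2E mulrCA ler_pM2l//; apply: ih => // k kn.
by have := xy k.+1 kn; rewrite (hc i Lx').2 (hc i Ly').2.
Qed.

Let expR_birkhoff_le1 (f : I -> R) x n : (forall i, 0 < f i) ->
  expR (- birkhoff f (c x) n) <= 1.
Proof.
move=> f0; rewrite -expR0 ler_expR oppr_le0.
by apply: sumr_ge0 => i _; exact: ltW.
Qed.

(** Different first columns would leave a gap [d], so points this close start in the same column;
    undoing the common map divides both sides by the same ratio. *)
Lemma columns_agree d x y n :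
  (forall i j x y, L x -> L y -> eta F i != eta F j ->
    `|(mapT F i x).1 - (mapT F j y).1| < d -> False) -> 0 < d ->
  L x -> L y -> `|x.1 - y.1| < d * expR (- birkhoff (lam1 F) (c x) n) ->
  forall j, (j < n)%N -> eta F (c x j) = eta F (c y j).
Proof.
move=> gap d0; elim: n x y => // n ih x y Lx Ly xy.
have [i [x' [Lx' xE]]] := attractor_preim Lx.
have [j [y' [Ly' yE]]] := attractor_preim Ly.
have ij : eta F i = eta F j.
  apply/eqP/negP => /negP ij; apply: (gap _ _ _ _ Lx' Ly' ij); rewrite -xE -yE.
  apply: lt_le_trans xy _; rewrite ler_piMr ?(ltW d0)//.
  exact: expR_birkhoff_le1 (lam1_gt0 hF).
subst x y; case=> [_|k kn]; first by rewrite (hc i Lx').1 (hc j Ly').1.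
rewrite (hc i Lx').2 (hc j Ly').2; apply: ih => //.
move: xy; rewrite mapT1_dist// birkhoffSl coding_shift// (hc i Lx').1 opprD expRD.
by rewrite beta1E mulrCA ltr_pM2l.
Qed.

Lemma symbols_agree d x y n :
  (forall i j x y, L x -> L y -> i != j ->
    `|(mapT F i x).1 - (mapT F j y).1| < d ->
    `|(mapT F i x).2 - (mapT F j y).2| < d -> False) -> 0 < d ->
  L x -> L y -> `|x.1 - y.1| < d * expR (- birkhoff (lam2 F) (c x) n) ->
  `|x.2 - y.2| < d * expR (- birkhoff (lam2 F) (c x) n) ->
  forall j, (j < n)%N -> c x j = c y j.
Proof.
move=> gap d0; elim: n x y => // n ih x y Lx Ly xy1 xy2.
have [i [x' [Lx' xE]]] := attractor_preim Lx.
have [j [y' [Ly' yE]]] := attractor_preim Ly.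
have ij : i = j.
  have e1 : d * expR (- birkhoff (lam2 F) (c x) n.+1) <= d.
    rewrite ler_piMr ?(ltW d0)//; exact: expR_birkhoff_le1 (lam2_gt0 hF).
  apply/eqP/negP => /negP ij; apply: (gap _ _ _ _ Lx' Ly' ij); rewrite -xE -yE.
    exact: lt_le_trans xy1 e1.
  exact: lt_le_trans xy2 e1.
subst x y j; case=> [_|k kn]; first by rewrite (hc i Lx').1 (hc i Ly').1.
rewrite (hc i Lx').2 (hc i Ly').2; move: xy1 xy2.
rewrite mapT1_dist// mapT2_dist birkhoffSl coding_shift// (hc i Lx').1 opprD expRD.
rewrite beta2E mulrCA ltr_pM2l// => xy1 xy2; apply: ih => //.
(* The first coordinate was contracted by [beta1], which exceeds [beta2], so its hypothesis survives
   division by [beta2]. *)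
rewrite -(ltr_pM2l (beta2_gt0 i)); apply: le_lt_trans xy1.
by apply: ler_wpM2r => //; exact: ltW.
Qed.

(** A cluster point of the images of [x0] under the prefixes of [s] works: by [symbols_agree],
    nearby points of [L] share any prescribed number of symbols. *)
Lemma coding_surj (s : nat -> I) : exists2 x, L x & c x = s.
Proof.
have [[x0 Lx0] cL _] := hL.
pose word := fix word n (s : nat -> I) := if n is n'.+1
  then mapT F (s 0%N) (word n' (fun j => s j.+1)) else x0.
have Lw n t : L (word n t).
  by elim: n t => //= n ih t; apply: attractor_map; exact: ih.
have cw n t j : (j < n)%N -> c (word n t) j = t j.
  elim: n t j => // n ih t [|j] jn /=; first by rewrite (hc _ (Lw _ _)).1.
  by rewrite (hc _ (Lw _ _)).2; exact: ih.
have wL : ((fun n => word n s) @ \oo) L by exists 0%N => // n _; exact: Lw.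
have [x [Lx clx]] := cL _ _ wL.
exists x => //; apply/funext => j.
have [d d0 gap] := symbol_gap.
pose e := d * expR (- birkhoff (lam2 F) (c x) j.+1).
have e0 : 0 < e by rewrite mulr_gt0// expR_gt0.
have tail : (word n s @[n --> \oo]) [set word n s | n in [set n | (j < n)%N]].
  by exists j.+1 => // n jn; exists n.
have [y [[n jn <-] [xy1 xy2]]] := clx _ _ tail (nbhsx_ballx _ _ e0).
rewrite (symbols_agree (n := j.+1) gap d0 Lx (Lw n s))//.
exact: cw.
Qed.

End Geometry.
End Coding.

(** * Approximate squares and their mass *)

Section Stopping.
Variables (R : realType) (I : finType) (f : I -> R).
Hypothesis f0 : forall i, 0 < f i.

Lemma le_birkhoff (s : nat -> I) k n :
  (k <= n)%N -> birkhoff f s k <= birkhoff f s n.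
Proof.
move=> /subnKC <-; elim: (n - k)%N => [|m ih]; first by rewrite addn0.
by rewrite addnS birkhoffSr; apply: (le_trans ih); rewrite lerDl ltW.
Qed.

Lemma birkhoff_unbounded (s : nat -> I) (t : R) : exists k, t <= birkhoff f s k.
Proof.
have [c c0 cf] := finite_lower_bound f0.
exists (Num.bound `|t / c|); rewrite -[leLHS](divfK (lt0r_neq0 c0)).
apply: (@le_trans _ _ ((Num.bound `|t / c|)%:R * c)).
  rewrite ler_pM2r//; apply: le_trans (ler_norm _) _.
  by apply: ltW; exact: archi_boundP.
rewrite /birkhoff mulr_natl -[X in _ *+ X]card_ord -sumr_const.
by apply: ler_sum => j _; exact: cf.
Qed.

Lemma stopping (s : nat -> I) (t : R) : 0 < t ->
  exists k, birkhoff f s k < t <= birkhoff f s k.+1.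
Proof.
move=> t0; case: (ex_minnP (birkhoff_unbounded s t)) => -[|k].
  by rewrite /birkhoff big_ord0 leNgt t0.
move=> tk kmin; exists k; rewrite tk andbT ltNge; apply/negP => /kmin.
by rewrite ltnn.
Qed.

(** It makes a bounded change of scale cost only a bounded change of log-mass. *)
Lemma birkhoff_lipschitz (g : I -> R) (a : R) (s : nat -> I) k n :
  (forall i, `|g i| <= a * f i) ->
  `|birkhoff g s k - birkhoff g s n| <= a * `|birkhoff f s k - birkhoff f s n|.
Proof.
move=> gf; wlog kn : k n / (k <= n)%N.
  by move=> h; have [/h//|/ltnW/h] := leqP k n; rewrite distrC [in leRHS]distrC.
rewrite distrC [in leRHS]distrC [in leRHS]ger0_norm; last first.
  by rewrite subr_ge0 le_birkhoff.
rewrite -(subnKC kn); elim: (n - k)%N => [|m ih].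
  by rewrite addn0 !subrr normr0 mulr0.
rewrite addnS !birkhoffSr addrAC [in leRHS]addrAC mulrDr.
by apply: le_trans (ler_normD _ _) _; apply: lerD.
Qed.

End Stopping.

Section Squares.
Variables (R : realType) (I : finType) (F : ifs R I).
Implicit Types (s : nat -> I) (w : I -> R).

Definition pattern_mass w (A : seq (pred I)) : R :=
  \prod_(X <- A) \sum_(i | X i) w i.

(* The approximate square around [s]: [k] symbols, then columns up to [n]. *)
Definition square s (k n : nat) : seq (pred I) :=
  mkseq (fun j => if (j < k)%N then (pred1 (s j) : pred I)
                  else fun i => eta F i == eta F (s j)) n.

(** Logarithms of the conditional probability of a symbol in its column and of the column itself. A
    square uses the first up to [k] and the second up to [n], each with its own clock. *)
Definition ln_fibre w (i : I) : R := ln (w i) - ln (colmass F w i).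
Definition ln_col w (i : I) : R := ln (colmass F w i).

Lemma square_massE w s k n : pattern_mass w (square s k n) =
  \prod_(j < n) (if (j < k)%N then w (s j) else colmass F w (s j)).
Proof.
rewrite /pattern_mass /square big_map -[n in LHS]subn0 -/(index_iota 0 n) big_mkord.
by apply: eq_bigr => j _; case: ifP => _ //; rewrite big_pred1_eq.
Qed.

Let ln_square w s k n : (k <= n)%N ->
  birkhoff (ln_fibre w) s k + birkhoff (ln_col w) s n =
  \sum_(j < n) (if (j < k)%N then ln (w (s j)) else ln (colmass F w (s j))).
Proof.
move=> kn; rewrite /birkhoff -(big_mkord xpredT (fun j => ln_fibre w (s j))).
rewrite (big_nat_widen _ _ _ _ _ kn) big_mkord big_mkcond -big_split/=.
apply: eq_bigr => j _; case: ifP => _; last by rewrite add0r.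
by rewrite /ln_fibre /ln_col subrK.
Qed.

Lemma square_mass w s k n : (forall i, 0 < w i) -> (k <= n)%N ->
  pattern_mass w (square s k n) =
  expR (birkhoff (ln_fibre w) s k + birkhoff (ln_col w) s n).
Proof.
move=> w0 kn; rewrite ln_square// expR_sum square_massE; apply: eq_bigr => j _.
have c0 : 0 < colmass F w (s j) by apply: colmass_gt0 => // i; exact: ltW.
by case: ifP => _; rewrite lnK ?posrE.
Qed.

(** Only an inequality, as weights may vanish: a factor 0 is then compared with
    [expR (ln 0) = 1]. *)
Lemma square_mass_le w s k n : (forall i, 0 <= w i) -> (k <= n)%N ->
  pattern_mass w (square s k n) <=
  expR (birkhoff (ln_fibre w) s k + birkhoff (ln_col w) s n).
Proof.
move=> w0 kn; rewrite ln_square// expR_sum square_massE.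
have le_expln (x : R) : 0 <= x -> 0 <= x <= expR (ln x).
  move=> x0; rewrite x0/=; have [->|x1] := eqVneq x 0; first exact: expR_ge0.
  by rewrite lnK ?lexx// posrE lt_def x1.
apply: ler_prod => j _; case: ifP => _; apply: le_expln => //.
exact: eta_vec_ge0.
Qed.

End Squares.

(** * Borel sets and discs of the plane *)

Section Plane.
Variable R : realType.
Implicit Types (U : set (R * R)) (x y : R * R).

Lemma open_measurable_plane U : open U -> measurable U.
Proof.
move=> oU.
pose box (q : (rat * rat) * (rat * rat)) : set (R * R) :=
  `]ratr q.1.1, ratr q.1.2[%classic `*` `]ratr q.2.1, ratr q.2.2[%classic.
pose B q := if `[< box q `<=` U >] then box q else set0.
have -> : U = \bigcup_q B q.
  apply/seteqP; split=> [[x1 x2] Ux|x [q _]]; last first.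
    by rewrite /B; case: asboolP => // h; exact: h.
  have := oU; rewrite openE => /(_ _ Ux) /nbhs_ballP[e /= e0 eU].
  have [a a1 a2] : exists2 a : rat, x1 - e < ratr a & ratr a < x1.
    have [|a] := @rat_in_itvoo R (x1 - e) x1; first lra.
    by rewrite in_itv/= => /andP[? ?]; exists a.
  have [b b1 b2] : exists2 b : rat, x1 < ratr b & ratr b < x1 + e.
    have [|b] := @rat_in_itvoo R x1 (x1 + e); first lra.
    by rewrite in_itv/= => /andP[? ?]; exists b.
  have [a' a'1 a'2] : exists2 a : rat, x2 - e < ratr a & ratr a < x2.
    have [|c] := @rat_in_itvoo R (x2 - e) x2; first lra.
    by rewrite in_itv/= => /andP[? ?]; exists c.
  have [b' b'1 b'2] : exists2 b : rat, x2 < ratr b & ratr b < x2 + e.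
    have [|c] := @rat_in_itvoo R x2 (x2 + e); first lra.
    by rewrite in_itv/= => /andP[? ?]; exists c.
  exists ((a, b), (a', b')) => //; rewrite /B asboolT.
    by rewrite /box/= !in_itv/= a2 b1 a'2 b'1.
  move=> [y1 y2] [/=]; rewrite !in_itv/= => /andP[? ?] /andP[? ?].
  by apply: eU; split; rewrite /ball/= ltr_norml; apply/andP; split; lra.
apply: countable_bigcupT_measurable; first exact: countableP.
move=> q; rewrite /B; case: asboolP => // _.
by apply: measurableX; exact: measurable_itv.
Qed.

Lemma closed_measurable_plane U : closed U -> measurable U.
Proof.
by move=> /closed_openC/open_measurable_plane/measurableC; rewrite setCK.
Qed.

Lemma cball_coord x y r : cball x r y -> `|x.1 - y.1| <= r /\ `|x.2 - y.2| <= r.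
Proof.
rewrite /cball/= => h; have r0 : 0 <= r := le_trans (sqrtr_ge0 _) h.
have {}h : (y.1 - x.1) ^+ 2 + (y.2 - x.2) ^+ 2 <= r ^+ 2.
  by rewrite -[leLHS]sqr_sqrtr ?addr_ge0 ?sqr_ge0// lerXn2r ?nnegrE ?sqrtr_ge0.
have h1 : 0 <= (y.1 - x.1) ^+ 2 by exact: sqr_ge0.
have h2 : 0 <= (y.2 - x.2) ^+ 2 by exact: sqr_ge0.
split; rewrite distrC -(ger0_norm r0) -ler_sqr ?nnegrE// !real_normK ?num_real//; lra.
Qed.

(** Half the radius absorbs the passage from the maximum norm to the Euclidean one. *)
Lemma coord_cball x y r : `|x.1 - y.1| <= r / 2 -> `|x.2 - y.2| <= r / 2 ->
  cball x r y.
Proof.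
move=> h1 h2; have r0 : 0 <= r.
  by have := le_trans (normr_ge0 _) h1; lra.
rewrite /cball/= -(ger0_norm r0) -sqrtr_sqr ler_sqrt ?sqr_ge0//.
have e1 : (y.1 - x.1) ^+ 2 <= (r / 2) ^+ 2.
  by rewrite -[leLHS]real_normK ?num_real// distrC ler_sqr ?nnegrE// divr_ge0.
have e2 : (y.2 - x.2) ^+ 2 <= (r / 2) ^+ 2.
  by rewrite -[leLHS]real_normK ?num_real// distrC ler_sqr ?nnegrE// divr_ge0.
apply: le_trans (lerD e1 e2) _; rewrite expr_div_n.
have : 0 <= r ^+ 2 by exact: sqr_ge0.
lra.
Qed.

Lemma cball_measurable x r : measurable (cball x r).
Proof.
apply: closed_measurable_plane.
apply: (@closed_comp _ _ (fun y => Num.sqrt ((y.1 - x.1) ^+ 2 + (y.2 - x.2) ^+ 2))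
  `]-oo, r]%classic) => [y _|]; last exact: interval_closed.
apply: (@continuous_comp _ R R (fun y : R * R => (y.1 - x.1) ^+ 2 + (y.2 - x.2) ^+ 2)
  (@Num.sqrt R)); last exact: sqrt_continuous.
have c1 : {for y, continuous (fun y : R * R => y.1 - x.1)}.
  by apply: continuous_atB; [exact: cvg_fst|exact: continuous_at_cst].
have c2 : {for y, continuous (fun y : R * R => y.2 - x.2)}.
  by apply: continuous_atB; [exact: cvg_snd|exact: continuous_at_cst].
by apply: continuous_atD; exact: continuous_atM.
Qed.

End Plane.

(** * Masses of cylinders for the self-affine measure *)

Section Measure.
Variables (R : realType) (I : finType) (F : ifs R I) (L : set (R * R)).
Variables (p : I -> R) (mu : probability (R * R)%type R).
Hypothesis hF : gatzouras_lalley F.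
Hypothesis hL : attractor F L.
Hypothesis hsep : separated_principal_projections F L.
Hypothesis hp : simplex p.
Hypothesis p0 : forall i, 0 < p i.
Hypothesis hmu : self_affine F p mu.

Let mreal (A : set (R * R)) : R := fine (mu A).

Let mrealE A : measurable A -> mu A = (mreal A)%:E.
Proof. by move=> mA; rewrite fineK// fin_num_measure. Qed.

Let mreal_ge0 A : 0 <= mreal A.
Proof. by rewrite fine_ge0. Qed.

Let mreal_le1 A : measurable A -> mreal A <= 1.
Proof.
by move=> mA; rewrite -lee_fin -mrealE//; exact: probability_le1.
Qed.

Let mreal_mono A B : measurable A -> measurable B -> A `<=` B ->
  mreal A <= mreal B.
Proof.
move=> mA mB AB; rewrite -lee_fin -!mrealE//.
by apply: le_measure => //; rewrite inE.
Qed.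

Let measurable_preim i A : measurable A -> measurable (mapT F i @^-1` A).
Proof.
move=> mA; rewrite -[_ @^-1` _]setTI.
have m1 : measurable_fun setT (fun x : R * R => beta1 F i * x.1 + d1 F i).
  apply: measurable_realfun.measurable_funD; last exact: measurable_cst.
  by apply: measurable_realfun.measurable_funM; [exact: measurable_cst|exact: measurable_fst].
have m2 : measurable_fun setT (fun x : R * R => beta2 F i * x.2 + d2 F i).
  apply: measurable_realfun.measurable_funD; last exact: measurable_cst.
  by apply: measurable_realfun.measurable_funM; [exact: measurable_cst|exact: measurable_snd].
have : measurable_fun setT (mapT F i) by exact: measurable_fun_pair m1 m2.
by apply.
Qed.

Let mreal_affine A : measurable A ->
  mreal A = \sum_i p i * mreal (mapT F i @^-1` A).
Proof.
move=> mA; rewrite /mreal hmu//.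
rewrite (eq_bigr (fun i => (p i * mreal (mapT F i @^-1` A))%:E)).
  by rewrite sumEFin.
by move=> i _; rewrite mrealE ?EFinM//; exact: measurable_preim.
Qed.

Let nbd (e : R) : set (R * R) := \bigcup_(y in L) ball y e.

Let nbd_open e : open (nbd e).
Proof. by apply: bigcup_open => y _; exact: ball_open. Qed.

Let nbd_measurable e : measurable (nbd e).
Proof. by apply: open_measurable_plane; exact: nbd_open. Qed.

Let nbd_mono e e' : e <= e' -> nbd e `<=` nbd e'.
Proof. by move=> ee x [y Ly yx]; exists y => //; exact: le_ball yx. Qed.

(** If [b] bounds all contraction ratios, every [mapT F i] sends the [e / b]-neighbourhood of [L]
    into the [e]-neighbourhood, and self-affinity compares their masses. *)
Let nbd_full : exists b : R, [/\ 0 < b, b < 1 &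
  forall e, 0 < e -> mreal (nbd (e / b)) <= mreal (nbd e)].
Proof.
have [c c0 cb] : exists2 c : R, 0 < c & forall i, c <= 1 - beta1 F i.
  by apply: finite_lower_bound => i; have [_ /(_ i)[/andP[_ ?]]] := hF; lra.
(* The cap [1 / 2] keeps this common ratio bound positive. *)
exists (1 - Num.min c (1 / 2)).
have m1 : Num.min c (1 / 2) <= c by rewrite ge_min lexx.
have m2 : Num.min c (1 / 2) <= 1 / 2 by rewrite ge_min lexx orbT.
have m3 : 0 < Num.min c (1 / 2) by rewrite lt_min c0 divr_gt0.
have b0 : 0 < 1 - Num.min c (1 / 2) by lra.
split=> //; first lra.
move=> e e0; rewrite [leRHS]mreal_affine// -[leLHS](avg_cst _ hp.2).
apply: ler_sum => i _; apply: ler_wpM2l; first exact: ltW.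
apply: mreal_mono => //; first exact: measurable_preim.
move=> x [y Ly [/= yx1 yx2]].
exists (mapT F i y); first exact: attractor_map.
have [_ /(_ i)[/andP[b10 _] /andP[b20 _] _] /(_ i) b21 _ _] := hF.
have bc := cb i.
split; rewrite /ball/= opprD addrACA subrr addr0 -mulrBr normrM gtr0_norm//.
  apply: (@le_lt_trans _ _ ((1 - Num.min c (1 / 2)) * `|y.1 - x.1|)).
    by apply: ler_wpM2r => //; lra.
  by rewrite mulrC -ltr_pdivlMr.
apply: (@le_lt_trans _ _ ((1 - Num.min c (1 / 2)) * `|y.2 - x.2|)).
  by apply: ler_wpM2r => //; lra.
by rewrite mulrC -ltr_pdivlMr.
Qed.

(** By iterating [nbd_full], the mass of [nbd e] dominates that of neighbourhoods which exhaust the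
    plane. *)
Let nbd1 e : 0 < e -> mu (nbd e) = 1%E.
Proof.
move=> e0; have [b [b0 b1 step]] := nbd_full.
have bn n : 0 < b ^+ n by exact: exprn_gt0.
have iterstep n : mreal (nbd (e / b ^+ n)) <= mreal (nbd e).
  elim: n => [|n ih]; first by rewrite expr0 divr1.
  apply: le_trans ih; rewrite exprSr invfM mulrA; apply: step.
  exact: divr_gt0.
have cover : \bigcup_n nbd (e / b ^+ n) = setT.
  apply/seteqP; split=> // x _; have [[y Ly] _ _] := hL.
  pose M := Num.max `|y.1 - x.1| `|y.2 - x.2|.
  have : (fun n => b ^+ n) @ \oo --> (0 : R).
    by apply: cvg_expr; rewrite ger0_norm ?ltW.
  have eM : 0 < e / (M + 1).
    by rewrite divr_gt0// ltr_wpDl// /M le_max normr_ge0.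
  move=> /cvgrPdist_lt/(_ _ eM)/filter_ex[n]; rewrite sub0r normrN gtr0_norm// => h.
  exists n => //; exists y => //.
  have M1 : 0 < M + 1 by rewrite ltr_wpDl// /M le_max normr_ge0.
  have Mn : M < e / b ^+ n.
    move: h; rewrite !ltr_pdivlMr// => h.
    by have := bn n; move: h; rewrite mulrDr mulr1 [M * _]mulrC; lra.
  by split; rewrite /ball/=; apply: le_lt_trans Mn; rewrite le_max lexx ?orbT.
have homo : {homo (fun n => nbd (e / b ^+ n)) : n m / (n <= m)%N >-> (n <= m)%O}.
  move=> n m nm; rewrite subsetEset; apply: nbd_mono.
  rewrite ler_pM2l// lef_pV2 ?posrE//.
  by apply: ler_wiXn2l => //; exact: ltW.
have := nondecreasing_cvg_mu (mu := mu) (fun n => nbd_measurable (e / b ^+ n)) _ homo.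
rewrite cover => /(_ measurableT) h.
apply/eqP; rewrite eq_le probability_le1//=.
rewrite -(probability_setT mu) -(cvg_lim _ h)//; apply: lime_le.
  by apply/cvg_ex; exists (mu setT).
by apply: nearW => n /=; rewrite !mrealE// lee_fin.
Qed.

Lemma attractor_closed : closed L.
Proof.
have [_ cL _] := hL.
exact: (compact_closed (@norm_hausdorff _ _) cL).
Qed.

Lemma mu_attractorC : mu (~` L) = 0%E.
Proof.
have mL : measurable L by apply: closed_measurable_plane; exact: attractor_closed.
apply/negligibleP; first exact: measurableC.
apply: (@negligibleS _ _ _ _ (\bigcup_n ~` nbd n.+1%:R^-1)).
  move=> x Lx; have := closed_openC attractor_closed; rewrite openE => /(_ _ Lx).
  move=> /nbhs_ballP[e /= e0 eL].
  have [n ne] : exists n : nat, n.+1%:R^-1 < e.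
    exists (Num.bound e^-1); rewrite -[ltRHS]invrK ltf_pV2 ?posrE ?invr_gt0//.
    apply: (@lt_trans _ _ (Num.bound e^-1)%:R); last by rewrite ltr_nat.
    by apply: archi_boundP; rewrite invr_ge0 ltW.
  exists n => // -[y Ly yx]; apply: (eL y) => //.
  by apply: ball_sym; exact: le_ball (ltW ne) _ yx.
apply: negligible_bigcup => n; apply/negligibleP.
  by apply: measurableC; exact: nbd_measurable.
have n0 : 0 < n.+1%:R^-1 :> R by rewrite invr_gt0.
by apply: etrans (probability_setC mu (nbd_measurable _)) _; rewrite nbd1// subee.
Qed.

Section Pattern.
Variables (c : R * R -> nat -> I) (hc : coding F L c).

Definition cylinder (A : seq (pred I)) : set (R * R) :=
  [set x | L x /\ forall j, (j < size A)%N -> nth (pred0 : pred I) A j (c x j)].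

Let pattern_massS X (A : seq (pred I)) :
  pattern_mass p (X :: A) = \sum_i (if X i then p i else 0) * pattern_mass p A.
Proof. by rewrite /pattern_mass big_cons -mulr_suml big_mkcond. Qed.

Let cylinderS i X (A : seq (pred I)) x : L x ->
  cylinder (X :: A) (mapT F i x) <-> X i /\ cylinder A x.
Proof.
move=> Lx; split=> [[_ h]|[Xi [_ h]]].
  split; first by have := h 0%N isT; rewrite (hc i Lx).1.
  by split=> // j jA; have := h j.+1 jA; rewrite (hc i Lx).2.
split=> [|[|j] jA]; first exact: attractor_map.
  by rewrite (hc i Lx).1.
by rewrite (hc i Lx).2; exact: h.
Qed.

(** Induction on the pattern: self-affinity replaces [B] by its preimages, which meet [L] inside the
    cylinder of the tail, or not at all if the first predicate rejects the symbol. With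
    [pattern_le_mu] it stands for [mu] being the image of a Bernoulli measure. *)
Lemma mu_le_pattern A B : measurable B -> B `&` L `<=` cylinder A ->
  fine (mu B) <= pattern_mass p A.
Proof.
rewrite -/(mreal B); elim: A B => [|X A ih] B mB BA.
  by rewrite /pattern_mass big_nil; exact: mreal_le1.
rewrite mreal_affine// pattern_massS; apply: ler_sum => i _.
have mB' := measurable_preim i mB.
case: ifP => Xi.
  apply: ler_wpM2l; [exact: ltW|apply: ih => // x [Bx Lx]].
  by have [] := (cylinderS i X A Lx).1
    (BA (mapT F i x) (conj Bx (attractor_map hL i Lx))).
suff -> : mreal (mapT F i @^-1` B) = 0 by rewrite mulr0 mul0r.
apply/eqP; rewrite eq_le mreal_ge0 andbT -[leRHS]/(fine 0) -mu_attractorC.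
apply: mreal_mono => //.
  by apply: measurableC; apply: closed_measurable_plane; exact: attractor_closed.
move=> x Bx Lx.
by have [] := (cylinderS i X A Lx).1
  (BA (mapT F i x) (conj Bx (attractor_map hL i Lx))); rewrite Xi.
Qed.

Lemma pattern_le_mu A B : measurable B -> cylinder A `<=` B ->
  pattern_mass p A <= fine (mu B).
Proof.
rewrite -/(mreal B); elim: A B => [|X A ih] B mB AB.
  rewrite /pattern_mass big_nil -[leLHS]/(fine 1).
  have mL : measurable L by apply: closed_measurable_plane; exact: attractor_closed.
  have <- : mu L = 1%E.
    by have := probability_setC mu (measurableC mL); rewrite setCK mu_attractorC sube0.
  by apply: mreal_mono => // x Lx; apply: AB.
rewrite mreal_affine// pattern_massS; apply: ler_sum => i _.
have mB' := measurable_preim i mB.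
case: ifP => Xi; last by rewrite mul0r mulr_ge0// ltW.
apply: ler_wpM2l; [exact: ltW|apply: ih => // x Ax].
by apply: AB; apply/cylinderS => //; case: Ax.
Qed.

End Pattern.
End Measure.

(** * Discs against approximate squares *)

Section BallMass.
Variables (R : realType) (I : finType) (F : ifs R I) (L : set (R * R)).
Variables (p : I -> R) (mu : probability (R * R)%type R).
Hypothesis hF : gatzouras_lalley F.
Hypothesis hL : attractor F L.
Hypothesis hsep : separated_principal_projections F L.
Hypothesis hp : simplex p.
Hypothesis p0 : forall i, 0 < p i.
Hypothesis hmu : self_affine F p mu.
Variables (c : R * R -> nat -> I) (hc : coding F L c).

Lemma square_cylinder x y k n : L y ->
  (forall j, (j < k)%N -> c x j = c y j) ->
  (forall j, (j < n)%N -> eta F (c x j) = eta F (c y j)) ->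
  cylinder L c (square F (c x) k n) y.
Proof.
move=> Ly xk xn; split=> // j; rewrite size_mkseq => jn; rewrite nth_mkseq//.
case: ifP => jk /=; first by rewrite (xk _ jk).
by rewrite (xn _ jn).
Qed.

Lemma cylinder_square x y k n : (k <= n)%N ->
  cylinder L c (square F (c x) k n) y ->
  (forall j, (j < k)%N -> c x j = c y j) /\
  (forall j, (j < n)%N -> eta F (c x j) = eta F (c y j)).
Proof.
move=> kn [_]; rewrite size_mkseq => h.
have hk j : (j < k)%N -> c x j = c y j.
  move=> jk; have jn := leq_trans jk kn.
  by have := h j jn; rewrite nth_mkseq// jk => /eqP.
split=> // j jn; have := h j jn; rewrite nth_mkseq//.
by case: ifP => [/hk ->//|_ /eqP].
Qed.

(* The [k]-th rectangle around [s] has height about [r], the [n]-th has width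
   about [r]. *)
Definition at_scale (C : R) (s : nat -> I) (r : R) (k n : nat) : Prop :=
  [/\ (k <= n)%N, `|birkhoff (lam2 F) s k + ln r| <= C
    & `|birkhoff (lam1 F) s n + ln r| <= C].

Lemma birkhoff_lam12 s n : birkhoff (lam1 F) s n <= birkhoff (lam2 F) s n.
Proof. by apply: ler_sum => j _; apply: ltW; exact: lam12. Qed.

Let stop_le s t k n : birkhoff (lam2 F) s k < t -> t <= birkhoff (lam1 F) s n.+1 ->
  (k <= n)%N.
Proof.
move=> kt tn; rewrite leqNgt; apply/negP => nk.
have := le_birkhoff (lam1_gt0 hF) s nk; have := birkhoff_lam12 s k; lra.
Qed.

(** Both levels are the last before the sums reach [ln (d / r)]; the rectangle sizes still exceed
    [r / d], so the gaps force the points of the disc to share symbols and columns. *)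
Lemma ball_sub_square : exists C r0 : R, 0 < r0 /\
  forall x r, L x -> 0 < r < r0 -> exists k n, at_scale C (c x) r k n /\
    cball x r `&` L `<=` cylinder L c (square F (c x) k n).
Proof.
have [d1 d10 gap1] := column_gap hL hsep.
have [d2 d20 gap2] := symbol_gap hL hsep.
have [A1 A10 A1P] := finite_upper_bound (lam1 F).
have [A2 A20 A2P] := finite_upper_bound (lam2 F).
pose d := Num.min d1 d2.
have d0 : 0 < d by rewrite lt_min d10.
have dd1 : d <= d1 by rewrite ge_min lexx.
have dd2 : d <= d2 by rewrite ge_min lexx orbT.
exists (`|ln d| + A1 + A2), d; split=> // x r Lx /andP[r0 rd].
have t0 : 0 < ln d - ln r by rewrite subr_gt0 ltr_ln ?posrE.
have [k /andP[k1 k2]] := stopping (lam2_gt0 hF) (c x) t0.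
have [n /andP[n1 n2]] := stopping (lam1_gt0 hF) (c x) t0.
exists k, n; split.
  split; first exact: stop_le k1 n2.
    move: k2; rewrite birkhoffSr => k2; have := A2P (c x k).
    by rewrite !ler_norml; have := ler_norm (ln d); have := ler_norm (- ln d);
      rewrite normrN => ? ? /andP[? ?]; apply/andP; split; lra.
  move: n2; rewrite birkhoffSr => n2; have := A1P (c x n).
  by rewrite !ler_norml; have := ler_norm (ln d); have := ler_norm (- ln d);
    rewrite normrN => ? ? /andP[? ?]; apply/andP; split; lra.
have rE : r = d * expR (- (ln d - ln r)).
  by rewrite opprB expRB !lnK ?posrE// mulrC divfK// gt_eqF.
move=> y [/cball_coord[xy1 xy2] Ly].
have r1 : r < d * expR (- birkhoff (lam1 F) (c x) n).
  by rewrite [ltLHS]rE ltr_pM2l// ltr_expR ltrN2.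
have r2 : r < d * expR (- birkhoff (lam2 F) (c x) k).
  by rewrite [ltLHS]rE ltr_pM2l// ltr_expR ltrN2.
apply: square_cylinder => //.
  apply: (symbols_agree hF hL hc _ d0 Lx Ly); last 2 first.
  - exact: le_lt_trans xy1 r2.
  - exact: le_lt_trans xy2 r2.
  by move=> i j x' y' Lx' Ly' ij h1 h2; apply: (gap2 _ _ _ _ Lx' Ly' ij);
    exact: lt_le_trans dd2.
apply: (columns_agree hF hL hc _ d0 Lx Ly); last exact: le_lt_trans xy1 r1.
by move=> i j x' y' Lx' Ly' ij h1; apply: (gap1 _ _ _ _ Lx' Ly' ij);
  exact: lt_le_trans dd1.
Qed.

Lemma square_sub_cball D x r k n :
  (forall x y, L x -> L y -> `|x.1 - y.1| <= D /\ `|x.2 - y.2| <= D) ->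
  0 < D -> 0 < r -> (k <= n)%N -> L x -> ln (2 * D) - ln r <= birkhoff (lam2 F) (c x) k ->
  ln (2 * D) - ln r <= birkhoff (lam1 F) (c x) n ->
  cylinder L c (square F (c x) k n) `<=` cball x r.
Proof.
move=> hD D0 r0 kn Lx hk hn y yQ; have Ly := yQ.1.
have [yk yn] := cylinder_square kn yQ.
have rE : r / 2 = D * expR (- (ln (2 * D) - ln r)).
  rewrite opprB expRB !lnK ?posrE ?mulr_gt0//.
  by field; rewrite gt_eqF.
apply: coord_cball.
  apply: le_trans (dist1_le hF hL hc hD Lx Ly yn) _.
  by rewrite [leRHS]rE ler_pM2l// ler_expR lerN2.
apply: le_trans (dist2_le hF hL hc hD Lx Ly yk) _.
by rewrite [leRHS]rE ler_pM2l// ler_expR lerN2.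
Qed.

Lemma square_sub_ball : exists C r0 : R, 0 < r0 /\
  forall x r, L x -> 0 < r < r0 -> exists k n, at_scale C (c x) r k n /\
    cylinder L c (square F (c x) k n) `<=` cball x r.
Proof.
have [D D0 hD] := attractor_bounded hL.
have [A1 A10 A1P] := finite_upper_bound (lam1 F).
have [A2 A20 A2P] := finite_upper_bound (lam2 F).
have D20 : 0 < 2 * D by rewrite mulr_gt0.
exists (`|ln (2 * D)| + A1 + A2), (2 * D); split=> // x r Lx /andP[r0 rd].
have t0 : 0 < ln (2 * D) - ln r by rewrite subr_gt0 ltr_ln ?posrE.
have [k /andP[k1 k2]] := stopping (lam2_gt0 hF) (c x) t0.
have [n /andP[n1 n2]] := stopping (lam1_gt0 hF) (c x) t0.
have kn : (k.+1 <= n.+1)%N by rewrite ltnS; exact: stop_le k1 n2.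
(* One level past the stopping index, since here the sums must have reached [ln (2 * D / r)]. *)
exists k.+1, n.+1; split; last exact: square_sub_cball hD D0 r0 kn Lx k2 n2.
split=> //.
  move: k2; rewrite birkhoffSr => k2; have := A2P (c x k).
  by rewrite !ler_norml; have := ler_norm (ln (2 * D)); have := ler_norm (- ln (2 * D));
    rewrite normrN => ? ? /andP[? ?]; apply/andP; split; lra.
move: n2; rewrite birkhoffSr => n2; have := A1P (c x n).
by rewrite !ler_norml; have := ler_norm (ln (2 * D)); have := ler_norm (- ln (2 * D));
  rewrite normrN => ? ? /andP[? ?]; apply/andP; split; lra.
Qed.

Lemma ratio_bound (f g : I -> R) : (forall i, 0 < f i) ->
  exists2 a : R, 0 < a & forall i, `|g i| <= a * f i.
Proof.
move=> f0; have [a a0 ga] := finite_upper_bound (fun i => g i / f i).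
exists a => // i; have := ga i; rewrite normrM normfV (gtr0_norm (f0 i)).
by rewrite ler_pdivrMr.
Qed.

Lemma at_scale_close (w : I -> R) (C C' : R) : exists M : R, forall s r k n k' n',
  at_scale C s r k n -> at_scale C' s r k' n' ->
  `|(birkhoff (ln_fibre F w) s k + birkhoff (ln_col F w) s n) -
    (birkhoff (ln_fibre F w) s k' + birkhoff (ln_col F w) s n')| <= M.
Proof.
have [a a0 ha] := ratio_bound (ln_fibre F w) (lam2_gt0 hF).
have [b b0 hb] := ratio_bound (ln_col F w) (lam1_gt0 hF).
exists (a * (C + C') + b * (C + C')) => s r k n k' n' [_ h1 h2] [_ h1' h2'].
rewrite opprD addrACA; apply: le_trans (ler_normD _ _) _; apply: lerD.
  apply: le_trans (birkhoff_lipschitz (lam2_gt0 hF) s k k' ha) _.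
  rewrite ler_pM2l//; move: h1 h1'; rewrite !ler_norml.
  by move=> /andP[? ?] /andP[? ?]; apply/andP; split; lra.
apply: le_trans (birkhoff_lipschitz (lam1_gt0 hF) s n n' hb) _.
rewrite ler_pM2l//; move: h2 h2'; rewrite !ler_norml.
by move=> /andP[? ?] /andP[? ?]; apply/andP; split; lra.
Qed.

Lemma cball_mass_gt0 : exists2 r0 : R, 0 < r0 &
  forall x r, L x -> 0 < r < r0 -> 0 < fine (mu (cball x r)).
Proof.
have [C [r0 [r00 h]]] := square_sub_ball; exists r0 => // x r Lx /(h _ _ Lx).
move=> [k [n [[kn _ _] sub]]].
apply: lt_le_trans (pattern_le_mu hF hL hp p0 hmu hc (cball_measurable x r) sub).
by rewrite square_mass// expR_gt0.
Qed.

(** The disc lies between two squares with levels of their own; [at_scale_close] moves both masses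
    to the given levels. *)
Lemma cball_mass (C : R) : exists M r0 : R, 0 < r0 /\
  forall x r k n, L x -> 0 < r < r0 -> at_scale C (c x) r k n ->
  `|ln (fine (mu (cball x r))) -
     (birkhoff (ln_fibre F p) (c x) k + birkhoff (ln_col F p) (c x) n)| <= M.
Proof.
have [C1 [r1 [r10 h1]]] := ball_sub_square.
have [C2 [r2 [r20 h2]]] := square_sub_ball.
have [r3 r30 h3] := cball_mass_gt0.
have [M1 hM1] := at_scale_close p C1 C.
have [M2 hM2] := at_scale_close p C2 C.
exists (M1 + M2), (Num.min r1 (Num.min r2 r3)).
split; first by rewrite !lt_min r10 r20.
move=> x r k n Lx; rewrite !lt_min => /and4P[r0 rr1 rr2 rr3] sc.
have m0 : 0 < fine (mu (cball x r)) by apply: h3 => //; rewrite r0.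
have [k1 [n1 [sc1 sub1]]] := h1 x r Lx (introT andP (conj r0 rr1)).
have [k2 [n2 [sc2 sub2]]] := h2 x r Lx (introT andP (conj r0 rr2)).
have := hM1 _ _ _ _ _ _ sc1 sc; have := hM2 _ _ _ _ _ _ sc2 sc.
have := mu_le_pattern hF hL hp p0 hmu hc (cball_measurable x r) sub1.
have := pattern_le_mu hF hL hp p0 hmu hc (cball_measurable x r) sub2.
have [kn1 _ _] := sc1; have [kn2 _ _] := sc2.
have mE : fine (mu (cball x r)) = expR (ln (fine (mu (cball x r)))).
  by rewrite lnK ?posrE.
rewrite !square_mass// {1 2}mE !ler_expR.
rewrite !ler_norml => ? ? /andP[? ?] /andP[? ?]; apply/andP; split; lra.
Qed.

Lemma supp_attractor : supp mu = L.
Proof.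
apply/seteqP; split=> x.
  move=> sx; apply: contrapT => Lx.
  have := sx _ (closed_openC (attractor_closed hL)) Lx.
  by rewrite (mu_attractorC hF hL hp p0 hmu) ltxx.
move=> Lx U oU Ux; have := oU; rewrite openE => /(_ _ Ux) /nbhs_ballP[e /= e0 eU].
have [r0 r00 h] := cball_mass_gt0.
pose r := Num.min (e / 2) (r0 / 2).
have rr : 0 < r by rewrite lt_min !divr_gt0.
have re : r <= e / 2 by rewrite ge_min lexx.
have rr0 : r <= r0 / 2 by rewrite ge_min lexx orbT.
have m0 : 0 < fine (mu (cball x r)) by apply: h => //; lra.
apply: (@lt_le_trans _ _ (mu (cball x r))).
  rewrite -[ltRHS]fineK ?lte_fin// fin_num_measure//; exact: cball_measurable.
apply: le_measure; rewrite ?inE; [exact: cball_measurable|exact: open_measurable_plane|].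
move=> y /cball_coord[y1 y2]; apply: eU.
by split; rewrite /ball/=; lra.
Qed.

End BallMass.

(** * Lower bound *)

Section Typical.
Variables (R : realType) (I : finType) (w : I -> R).
Hypothesis ws : simplex w.

Let drift (f : I -> R) (e : R) (u : seq I) : R := \sum_(i <- u) (f i - avg w f - e).

Let drift_mkseq f e s k :
  drift f e (mkseq s k) = birkhoff f s k - k%:R * avg w f - k%:R * e.
Proof.
rewrite /drift /birkhoff big_map -[k in iota _ k]subn0 -/(index_iota 0 k) big_mkord.
by rewrite !sumrB !sumr_const card_ord !mulr_natl.
Qed.

(** [G] adds exponential supermartingales for all [f j] and [- f j]. Staying below 1 bounds every
    summand at all times, which gives one [K] for all such sequences. *)
Lemma typical_supermartingale (J : finType) (f : J -> I -> R) (e : R) : 0 < e ->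
  exists (K : R) (G : seq I -> R),
    [/\ 0 <= K, forall u, 0 <= G u, forall u, \sum_a w a * G (rcons u a) <= G u,
      G [::] <= 1 / 2
    & forall s, (forall k, G (mkseq s k) < 1) -> forall j k,
        `|birkhoff (f j) s k - k%:R * avg w (f j)| <= e * k%:R + K].
Proof.
move=> e0; have [w0 w1] := ws.
pose f' (z : J * bool) : I -> R := if z.2 then f z.1 else (fun i => - f z.1 i).
have /choice[a aP] : forall z, exists a, 0 < a /\
    \sum_i w i * expR (a * (f' z i - avg w (f' z) - e)) <= 1.
  by move=> z; have [a] := exponential_supermartingale ws (f' z) e0; exists a.
have [a0 a00 a0P] := finite_lower_bound (fun z => (aP z).1).
pose m : R := #|{: J * bool}|%:R.
have m0 : 0 <= m by rewrite /m ler0n.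
have m1 : 1 < 2 * (m + 1) by lra.
(* Each of the [m] summands then starts at or below [1 / (2 * (m + 1))], hence [G] at or below
   [1 / 2]. *)
pose K := ln (2 * (m + 1)) / a0.
have K0 : 0 <= K by rewrite divr_ge0 ?(ltW a00)// ln_ge0// ltW.
exists K, (fun u => \sum_z expR (a z * (drift (f' z) e u - K))); split=> //.
- by move=> u; apply: sumr_ge0 => z _; exact: expR_ge0.
- move=> u; under eq_bigr do rewrite mulr_sumr.
  rewrite exchange_big/=; apply: ler_sum => z _.
  rewrite (eq_bigr (fun i => w i * expR (a z * (f' z i - avg w (f' z) - e)) *
      expR (a z * (drift (f' z) e u - K)))).
    by rewrite -mulr_suml -[leRHS]mul1r ler_wpM2r ?expR_ge0//; case: (aP z).
  move=> i _; rewrite -mulrA -expRD -mulrDr; congr (_ * expR (_ * _)).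
  by rewrite /drift -cats1 big_cat big_seq1/=; ring.
- apply: (@le_trans _ _ (\sum_(z : J * bool) (2 * (m + 1))^-1)).
    apply: ler_sum => z _; rewrite /drift big_nil sub0r.
    rewrite -[leRHS](lnK (x := _^-1)) ?posrE ?invr_gt0 ?(lt_trans _ m1)//.
    rewrite ler_expR lnV ?posrE ?(lt_trans _ m1)// mulrN lerN2 /K mulrA.
    by rewrite ler_pdivlMr// mulrC ler_wpM2r// ln_ge0// ltW.
  rewrite sumr_const -[_ *+ #|_|]mulr_natl -/m ler_pdivrMr; lra.
move=> s sG j k.
have h z : drift (f' z) e (mkseq s k) < K.
  have [az _] := aP z.
  have : expR (a z * (drift (f' z) e (mkseq s k) - K)) < expR 0.
    rewrite expR0; apply: le_lt_trans (sG k).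
    by rewrite [leRHS](bigD1 z)//= lerDl; apply: sumr_ge0 => z' _; exact: expR_ge0.
  by rewrite ltr_expR pmulr_rlt0// subr_lt0.
have := h (j, true); have := h (j, false); rewrite !drift_mkseq /f'/=.
have -> : birkhoff (fun i => - f j i) s k = - birkhoff (f j) s k.
  by rewrite /birkhoff -sumrN.
have -> : avg w (fun i => - f j i) = - avg w (f j).
  by rewrite /avg -sumrN; apply: eq_bigr => i _; rewrite mulrN.
by move=> ? ?; rewrite ler_norml; apply/andP; split; lra.
Qed.

(** Trades the number [k] of symbols for the logarithmic scale [t]: the sum of [lam] is the clock,
    and [k <= a * (t + C)] turns an error linear in [k] into one linear in [t]. *)
Lemma birkhoff_at_scale (f lam : I -> R) s k (e K C a t : R) :
  0 <= e -> 0 <= K -> 0 < avg w lam -> (forall i, 1 <= a * lam i) -> 0 <= a ->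
  `|birkhoff f s k - k%:R * avg w f| <= e * k%:R + K ->
  `|birkhoff lam s k - k%:R * avg w lam| <= e * k%:R + K ->
  `|birkhoff lam s k - t| <= C ->
  `|birkhoff f s k - t * (avg w f / avg w lam)|
    <= (1 + `|avg w f / avg w lam|) * (e * (a * (t + C)) + K + C).
Proof.
move=> e0 K0 l0 al a0 h1 h2 h3.
set b := avg w f / avg w lam.
have fb : avg w f = b * avg w lam by rewrite divfK ?gt_eqF.
have k0 : 0 <= k%:R :> R by exact: ler0n.
have kt : k%:R <= a * (t + C).
  apply: (@le_trans _ _ (a * birkhoff lam s k)).
    rewrite /birkhoff mulr_sumr -[k in k%:R]card_ord -sum1_card natr_sum.
    by apply: ler_sum => j _.
  apply: ler_wpM2l => //; move: h3; rewrite ler_norml => /andP[_]; lra.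
have ek : e * k%:R <= e * (a * (t + C)) by exact: ler_wpM2l.
have C0 : 0 <= C by exact: le_trans (normr_ge0 _) h3.
have -> : birkhoff f s k - t * b = (birkhoff f s k - k%:R * avg w f)
  + b * (birkhoff lam s k - t) - b * (birkhoff lam s k - k%:R * avg w lam).
  by rewrite fb; ring.
apply: le_trans (ler_normB _ _) _.
apply: le_trans (lerD (ler_normD _ _) (lexx _)) _.
move: fb; clearbody b => fb; rewrite !normrM mulrDl mul1r.
have b0 : 0 <= `|b| := normr_ge0 _.
have := ler_wpM2l b0 h2; have := ler_wpM2l b0 h3; have := ler_wpM2l b0 ek.
move=> *; lra.
Qed.

End Typical.

Section LowerBound.
Variables (R : realType) (I : finType) (F : ifs R I) (L : set (R * R)).
Variables (p : I -> R) (mu : probability (R * R)%type R) (q : R).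
Hypothesis hF : gatzouras_lalley F.
Hypothesis hL : attractor F L.
Hypothesis hsep : separated_principal_projections F L.
Hypothesis hp : simplex p.
Hypothesis p0 : forall i, 0 < p i.
Hypothesis hmu : self_affine F p mu.
Variables (c : R * R -> nat -> I) (hc : coding F L c).

(* Minus the exponent, along [w]-typical points, of the Bernoulli measure [x]:
   [exponent w p = - udim F p w] and [exponent w w = - vdim F w]. *)
Definition exponent (w x : I -> R) : R :=
  avg w (ln_fibre F x) / avg w (lam2 F) + avg w (ln_col F x) / avg w (lam1 F).

Lemma objective_exponent w : (forall i, 0 <= w i) ->
  objective F p q w = exponent w w - q * exponent w p.
Proof.
move=> w0; rewrite objectiveE// /exponent /ln_fibre /ln_col !avgB; ring.
Qed.

Lemma typical_ball (w : I -> R) (g : R) : simplex w -> 0 < g ->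
  exists (G : seq I -> R) (M r0 : R),
  [/\ forall u, 0 <= G u, forall u, \sum_a w a * G (rcons u a) <= G u,
      G [::] <= 1 / 2, 0 < r0 &
      forall x, L x -> (forall k, G (mkseq (c x) k) < 1) ->
      forall r, 0 < r < r0 -> exists A,
        [/\ cball x r `&` L `<=` cylinder L c A, 0 < fine (mu (cball x r)),
            pattern_mass w A <= expR (- ln r * (exponent w w + g) + M)
          & `|ln (fine (mu (cball x r))) + ln r * exponent w p| <= - ln r * g + M]].
Proof.
move=> ws g0; have [w0 w1] := ws.
have [C [r1 [r10 sub]]] := ball_sub_square hF hL hsep hc.
have [M1 [r2 [r20 mass]]] := cball_mass hF hL hsep hp p0 hmu hc C.
have [r3 r30 mass0] := cball_mass_gt0 hF hL hp p0 hmu hc.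
have [l l0 ll] := finite_lower_bound (lam1_gt0 hF).
pose a := l^-1; have a0 : 0 < a by rewrite invr_gt0.
have al1 i : 1 <= a * lam1 F i by rewrite mulrC ler_pdivlMr// mul1r.
have al2 i : 1 <= a * lam2 F i.
  by apply: (le_trans (al1 i)); rewrite ler_pM2l// ltW// lam12.
have l10 : 0 < avg w (lam1 F) := avg_gt0 ws (lam1_gt0 hF).
have l20 : 0 < avg w (lam2 F) := avg_gt0 ws (lam2_gt0 hF).
pose b1 := avg w (ln_fibre F w) / avg w (lam2 F).
pose b2 := avg w (ln_col F w) / avg w (lam1 F).
pose b3 := avg w (ln_fibre F p) / avg w (lam2 F).
pose b4 := avg w (ln_col F p) / avg w (lam1 F).
pose B := 1 + `|b1| + `|b2| + `|b3| + `|b4|.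
have bb1 : 0 <= `|b1| := normr_ge0 _.
have bb2 : 0 <= `|b2| := normr_ge0 _.
have bb3 : 0 <= `|b3| := normr_ge0 _.
have bb4 : 0 <= `|b4| := normr_ge0 _.
have B0 : 0 < B by rewrite /B; lra.
have B1 : 1 + `|b1| <= B by rewrite /B; lra.
have B2 : 1 + `|b2| <= B by rewrite /B; lra.
have B3 : 1 + `|b3| <= B by rewrite /B; lra.
have B4 : 1 + `|b4| <= B by rewrite /B; lra.
(* With this [e] the linear error of each of the two sums in a log-mass is at most [t * g / 2]. *)
pose e := g / (2 * B * a).
have e0 : 0 < e by rewrite divr_gt0// !mulr_gt0.
(* The first two functions are the clocks; the other four give the masses for [w] and [p]. *)
pose f (j : 'I_6) : I -> R := nth (lam1 F) [:: lam1 F; lam2 F;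
  ln_fibre F w; ln_col F w; ln_fibre F p; ln_col F p] j.
have [K [G [K0 G0 GS G1 typ]]] := typical_supermartingale ws f e0.
have C0 : 0 <= `|C| := normr_ge0 _.
pose M2 := 2 * B * (e * (a * `|C|) + K + `|C|).
exists G, (M2 + `|M1|), (Num.min 1 (Num.min r1 (Num.min r2 r3))); split=> //.
  by rewrite !lt_min ltr01 r10 r20.
move=> x Lx xG r; rewrite !lt_min => /and5P[r0 rr rr1 rr2 rr3].
have [k [n [sc rsub]]] := sub x r Lx (introT andP (conj r0 rr1)).
have [kn sck scn] := sc.
have lr : ln r <= 0 by apply: ln_le0; exact: ltW.
have m0 := mass0 x r Lx (introT andP (conj r0 rr3)).
pose t := - ln r; have t0 : 0 <= t by rewrite oppr_ge0.
have bnd h lam m bh : (forall i, 1 <= a * lam i) -> 0 < avg w lam ->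
    bh = avg w h / avg w lam -> 1 + `|bh| <= B ->
    `|birkhoff h (c x) m - m%:R * avg w h| <= e * m%:R + K ->
    `|birkhoff lam (c x) m - m%:R * avg w lam| <= e * m%:R + K ->
    `|birkhoff lam (c x) m + ln r| <= C ->
    `|birkhoff h (c x) m - t * bh| <= t * g / 2 + M2 / 2.
  move=> al lam0 -> hB h1 h2 h3.
  have h3' : `|birkhoff lam (c x) m - t| <= `|C|.
    by rewrite opprK; exact: le_trans h3 (ler_norm _).
  apply: le_trans (birkhoff_at_scale (ltW e0) K0 lam0 al (ltW a0) h1 h2 h3') _.
  have S0 : 0 <= e * (a * (t + `|C|)) + K + `|C|.
    by rewrite !addr_ge0// mulr_ge0 ?(ltW e0)// mulr_ge0 ?(ltW a0)// addr_ge0.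
  apply: le_trans (ler_wpM2r S0 hB) _.
  rewrite /M2 le_eqVlt; apply/orP; left; apply/eqP.
  have -> : t * g / 2 = B * (e * (a * t)).
    by rewrite /e; field; rewrite !gt_eqF.
  by field.
have typx := typ (c x) xG.
have e1 := typx (@Ordinal 6 0 isT) n; have e2 := typx (@Ordinal 6 1 isT) k.
exists (square F (c x) k n); split; rewrite -/t //.
- have e3 := typx (@Ordinal 6 2 isT) k; have e4 := typx (@Ordinal 6 3 isT) n.
  apply: le_trans (square_mass_le _ _ w0 kn) _; rewrite ler_expR.
  have := bnd _ _ _ b1 al2 l20 erefl B1 e3 e2 sck.
  have := bnd _ _ _ b2 al1 l10 erefl B2 e4 e1 scn.
  rewrite !ler_norml /exponent -/b1 -/b2 => /andP[_ h1] /andP[_ h2].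
  have : 0 <= `|M1| := normr_ge0 _.
  by rewrite mulrDr mulrDr; clear -h1 h2; lra.
have e3 := typx (@Ordinal 6 4 isT) k; have e4 := typx (@Ordinal 6 5 isT) n.
have := mass x r k n Lx (introT andP (conj r0 rr2)) sc.
have := bnd _ _ _ b3 al2 l20 erefl B3 e3 e2 sck.
have := bnd _ _ _ b4 al1 l10 erefl B4 e4 e1 scn.
rewrite !ler_norml /exponent -/b3 -/b4.
move=> /andP[h1 h1'] /andP[h2 h2'] /andP[h3 h3'].
have := ler_norm M1; have -> : ln r = - t by rewrite opprK.
rewrite (mulNr t (b3 + b4)) (mulrDr t b3 b4) => H.
by clear -h1 h1' h2 h2' h3 h3' H; apply/andP; split; lra.
Qed.

(** If the measure were finite, the typical set [E] would have covers by small discs of total weight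
    below [H + 1], each weight being at least [4 * (H + 1)] times the [w]-mass of a cylinder around
    the disc. These masses add up to at most [1 / 4] and typicality costs [1 / 2], so some typical
    point avoids the cover. *)
Lemma Hmeas_lower (w : I -> R) (t : R) : simplex w -> t < - objective F p q w ->
  ~ (Hmeas mu q t L < +oo)%E.
Proof.
move=> ws tw Hfin; have [w0 w1] := ws.
pose gap := - objective F p q w - t.
have gap0 : 0 < gap by rewrite subr_gt0.
(* The deviations [gap / Q], once in the [w]-mass and [|q|] times in the disc mass, use up half of
   [gap]. *)
pose Q := 2 * (1 + `|q|).
have q0 : 0 <= `|q| := normr_ge0 _.
have Q0 : 0 < Q by rewrite mulr_gt0//; lra.
have [G [M [r0 [G0 GS G1 r00 typ]]]] := typical_ball ws (divr_gt0 gap0 Q0).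
have [H HE] : exists H : R, 0 <= H /\ forall A d, A `<=` L -> 0 < d ->
    (Hpre mu q t d A <= H%:E)%E.
  exists `|fine (Hmeas mu q t L)|; split=> // A d AL d0.
  have AH : (Hpre mu q t d A <= Hmeas mu q t L)%E.
    by apply: ereal_sup_ubound; exists A, d.
  apply: le_trans AH _; move: Hfin; case: (Hmeas mu q t L) => [x| |]//= _.
    by rewrite lee_fin ler_norm.
  by rewrite leNye.
have {HE} [H0 HE] := HE.
(* [Hmeas] is a supremum over subsets, so [E] may replace [L]; the centres of its covers are then
   typical, as [typical_ball] requires. *)
pose E := [set x | L x /\ forall k, G (mkseq (c x) k) < 1].
pose big := ln (4 * (H + 1)) + (1 + `|q|) * `|M|.
(* For radii up to [d] the other half of [gap * (- ln r)] dominates the constants collected in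
   [big]. *)
pose d := Num.min (r0 / 2) (expR (- (2 * `|big| / gap))).
have d0 : 0 < d by rewrite lt_min divr_gt0// expR_gt0.
have HE1 : (Hpre mu q t d E < (H + 1)%:E)%E.
  apply: le_lt_trans (HE E d _ d0) _; first by move=> y [].
  by rewrite lte_fin ltrDl.
have [_ [D [x [r [[cov1 cov2] ->]]]] hsum] := ereal_inf_lt HE1.
pose wt n := fine (mu (cball (x n) (r n))) `^ q * r n `^ t.
have wt0 n : 0 <= wt n by rewrite mulr_ge0// powR_ge0.
have /choice[A AP] : forall n, exists A,
    (D n -> cball (x n) (r n) `&` L `<=` cylinder L c A /\
    4 * (H + 1) * pattern_mass w A <= wt n) /\ (~ D n -> pattern_mass w A = 0).
  move=> n; have [Dn|Dn] := pselect (D n); last first.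
    (* Outside [D] an impossible pattern keeps the family indexed by all of [nat]. *)
    by exists [:: fun=> false]; split=> // _; rewrite /pattern_mass big_seq1 big_pred0.
  have [[Lxn xnG] /andP[rn0 rnd]] := cov1 n Dn.
  have rnr0 : 0 < r n < r0.
    have : d <= r0 / 2 by rewrite ge_min lexx.
    by rewrite rn0; lra.
  have [A [Asub m0 Amass Bmass]] := typ _ Lxn xnG _ rnr0.
  exists A; split=> // _; split=> //.
  have H4 : 0 < 4 * (H + 1) by rewrite mulr_gt0// ltr_wpDl.
  rewrite /wt /powR !gt_eqF// -expRD -(lnK H4).
  apply: le_trans (ler_wpM2l (expR_ge0 _) Amass) _.
  rewrite -expRD ler_expR.
  have rd : ln (r n) <= - (2 * `|big| / gap).
    rewrite -[leRHS]expRK ler_ln ?posrE ?expR_gt0//; apply: le_trans rnd _.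
    by rewrite ge_min lexx orbT.
  pose tau := - ln (r n).
  have tauE : ln (r n) = - tau by rewrite opprK.
  clearbody tau.
  rewrite tauE lerN2 in rd; move: Bmass; rewrite !tauE opprK => Bmass.
  have gt : `|big| <= gap * tau / 2.
    by move: rd; rewrite ler_pdivrMr// => ?; lra.
  have big0 := ler_norm big.
  have tau0 : 0 <= tau by apply: le_trans rd; rewrite divr_ge0 ?mulr_ge0// ltW.
  move: Bmass; set m := ln (fine _) => Bmass.
  have qm : `|q * (m - tau * exponent w p)| <= `|q| * (tau * (gap / Q) + M).
    by rewrite normrM; apply: ler_wpM2l => //; rewrite -mulNr.
  have := ler_norm (- (q * (m - tau * exponent w p))); rewrite normrN => qm'.
  have gQ : (1 + `|q|) * (tau * (gap / Q)) = gap * tau / 2.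
    by rewrite /Q; field; rewrite gt_eqF//; lra.
  have MM : (1 + `|q|) * M <= (1 + `|q|) * `|M|.
    by apply: ler_wpM2l; [lra|exact: ler_norm].
  move: gt big0; rewrite /big; set nb := `|_ + _| => gt big0.
  have gapE : gap * tau = tau * (q * exponent w p) - tau * exponent w w - t * tau.
    by rewrite /gap objective_exponent//; ring.
  move: MM gQ big0 qm' qm.
  rewrite !(mulrDl 1 `|q|) !mul1r (mulrDr tau (exponent w w) (gap / Q)) (mulrBr q m)
    (mulrDr `|q| (tau * (gap / Q)) M).
  set lnH := ln _; set x1 := tau * (gap / Q); move: gapE gt; clear.
  by set x2 := gap * tau; move=> *; lra.
(* Index 0 enforces typicality, index [n.+1] avoidance of the [n]-th disc. *)
pose g n := if n is n'.+1 then cond_mass w (A n') else G.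
have gsum N : \sum_(n < N) g n [::] <= 3 / 4.
  apply: (@le_trans _ _ (\sum_(n < N.+1) g n [::])).
    rewrite big_ord_recr/= lerDl; case: N => [|N]; first exact: G0.
    exact: cond_mass_ge0.
  rewrite big_ord_recl/=.
  have : \sum_(n < N) cond_mass w (A n) [::] <= 1 / 4; last lra.
  have : 4 * (H + 1) * \sum_(n < N) cond_mass w (A n) [::] <= H + 1.
    rewrite mulr_sumr.
    apply: (@le_trans _ _ (\sum_(0 <= n < N | n \in D) wt n)).
      rewrite big_mkord [leRHS]big_mkcond; apply: ler_sum => n _.
      rewrite cond_mass_nil -/(pattern_mass _ _); have [Dn Dn'] := AP n.
      case: ifPn => nD; first by have [_] := Dn (set_mem nD).
      by rewrite Dn' ?mulr0// => /mem_set; apply/negP.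
    rewrite -lee_fin -sumEFin; apply: le_trans (ltW hsum).
    have wtE n : n \in D -> (0 <= (wt n)%:E)%E by rewrite lee_fin.
    rewrite -[D in \esum_(_ in D) _]set_mem_set -nneseries_esum//.
    by apply: (@nneseries_lim_ge R (fun n => (wt n)%:E)) => n _; exact: wtE.
  have H1 : 0 < H + 1 by lra.
  by rewrite mulrAC -[leRHS]mul1r ler_pM2r// => ?; lra.
have g0 n u : 0 <= g n u by case: n => [|n]; [exact: G0|exact: cond_mass_ge0].
have gS n u : \sum_a w a * g n (rcons u a) <= g n u.
  by case: n => [|n] /=; [exact: GS|rewrite cond_mass_martingale].
have [s sP] := supermartingale_selection ws g0 gS gsum.
have gs n k : g n (mkseq s k) < 1.
  apply: (@le_lt_trans _ _ (3 / 4)); last lra.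
  apply: le_trans (sP k n.+1); rewrite big_ord_recr/= lerDr.
  by apply: sumr_ge0 => j _; exact: g0.
have [y Ly ys] := coding_surj hF hL hsep hc s.
have yE : E y by split=> // k; rewrite ys; exact: (gs 0%N).
have [n Dn yn] := cov2 y yE.
have [Asub _] := (AP n).1 Dn.
have [_ yA] := Asub y (conj yn Ly); rewrite ys in yA.
by have := gs n.+1 (size (A n)); rewrite /= cond_mass_match// ltxx.
Qed.

End LowerBound.

(** * Upper bound *)

Section Empirical.
Variables (R : realType) (K : finType).
Implicit Types (u : seq K) (f : K -> R).

Lemma sum_count_mem u f :
  \sum_(i <- u) f i = \sum_i (count_mem i u)%:R * f i.
Proof.
elim: u => [|j u ih].
  by rewrite big_nil big1// => i _; rewrite mul0r.
rewrite big_cons ih [RHS](eq_bigr (fun i => (j == i)%:R * f i + (count_mem i u)%:R * f i)).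
  rewrite big_split/=; congr (_ + _).
  rewrite (bigD1 j)//= eqxx mul1r big1 ?addr0// => i /negbTE.
  by rewrite eq_sym => ->; rewrite mul0r.
by move=> i _ /=; rewrite natrD mulrDl.
Qed.

Lemma sum_count_size u : (\sum_i count_mem i u = size u)%N.
Proof.
elim: u => [|j u ih]; first by rewrite big1.
rewrite /= big_split/= ih (bigD1 j)//= eqxx big1 ?addn0// => i /negbTE.
by rewrite eq_sym => ->.
Qed.

Definition emp u (i : K) : R := (count_mem i u)%:R / (size u)%:R.

Lemma emp_ge0 u i : 0 <= emp u i.
Proof. by rewrite divr_ge0 ?ler0n. Qed.

Lemma emp_gt0 u i : i \in u -> 0 < emp u i.
Proof.
move=> iu; rewrite divr_gt0// ltr0n; last by case: u iu.
by rewrite -has_count has_pred1.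
Qed.

Lemma emp_simplex u : (0 < size u)%N -> simplex (emp u).
Proof.
move=> u0; split=> [i|]; first exact: emp_ge0.
by rewrite /emp -mulr_suml -natr_sum sum_count_size divff// pnatr_eq0 -lt0n.
Qed.

Lemma avg_emp u f : (0 < size u)%N ->
  (size u)%:R * avg (emp u) f = \sum_(i <- u) f i.
Proof.
move=> u0; rewrite sum_count_mem /avg mulr_sumr; apply: eq_bigr => i _.
by rewrite /emp mulrA mulrCA divff ?mulr1// pnatr_eq0 -lt0n.
Qed.

Fixpoint words (k : nat) : seq (seq K) :=
  if k is k'.+1 then [seq i :: u | i <- enum K, u <- words k'] else [:: [::]].

Lemma mem_words u : u \in words (size u).
Proof.
elim: u => [|i u ih] /=; first by rewrite inE.
by apply/allpairsP; exists (i, u); rewrite mem_enum.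
Qed.

Lemma sum_words f k :
  \sum_(u <- words k) \prod_(i <- u) f i = (\sum_i f i) ^+ k.
Proof.
elim: k => [|k ih]; first by rewrite big_seq1 big_nil expr0.
rewrite big_allpairs_dep big_enum/= exprS -ih mulr_suml.
apply: eq_bigr => i _; rewrite mulr_sumr.
by apply: eq_bigr => u _; rewrite big_cons.
Qed.

End Empirical.

Lemma ler_sum_uniq_sub (R : realType) (T : eqType) (s s' : seq T) (f : T -> R) :
  (forall x, 0 <= f x) -> uniq s -> {subset s <= s'} ->
  \sum_(x <- s) f x <= \sum_(x <- s') f x.
Proof.
move=> f0; elim: s s' => [|x s ih] s' /=.
  by rewrite big_nil sumr_ge0.
move=> /andP[xs us] ss'; have xs' : x \in s' by apply: ss'; rewrite mem_head.
rewrite big_cons (perm_big _ (perm_to_rem xs')) big_cons lerD2l; apply: ih => //.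
move=> y ys; have : y \in s' by apply: ss'; rewrite inE ys orbT.
rewrite (perm_mem (perm_to_rem xs')) inE => /predU1P[yx|//].
by rewrite -yx ys in xs.
Qed.

Lemma sum_geometric_le (R : realType) (a : R) n : 0 <= a < 1 ->
  \sum_(j < n) a ^+ j <= (1 - a)^-1.
Proof.
move=> /andP[a0 a1]; have a1' : 0 < 1 - a by rewrite subr_gt0.
rewrite -[leRHS]mul1r ler_pdivlMr// mulrC -opprB mulNr -subrX1 opprB.
by rewrite lerBlDr lerDl exprn_ge0.
Qed.

(* Summing over the types (= count vectors) of words converges because a type
   records the lengths, so the decay in the lengths factorises over letters. *)
Lemma sum_types_le (R : realType) (K : finType) (a : R) M : 0 <= a < 1 ->
  \sum_(f : {ffun K -> 'I_M}) a ^+ (\sum_i f i)%N <= ((1 - a)^-1) ^+ #|K|.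
Proof.
move=> a01; rewrite (eq_bigr (fun f : {ffun K -> 'I_M} => \prod_i a ^+ f i)).
  rewrite -(bigA_distr_bigA (fun (_ : K) (j : 'I_M) => a ^+ j))/= prodr_const.
  have a0 : 0 <= a by case/andP: a01.
  rewrite lerXn2r ?nnegrE ?sum_geometric_le//.
    by apply: sumr_ge0 => j _; exact: exprn_ge0.
  by rewrite invr_ge0 subr_ge0 ltW//; case/andP: a01.
move=> f _; elim/big_rec2: _ => [|i x y _ <-]; first by rewrite expr0.
by rewrite exprD.
Qed.

Section Bernoulli.
Variables (R : realType) (I : finType) (F : ifs R I).
Implicit Types (z : seq I * seq (column F)).

Definition columns_of z : seq (column F) := map (eta F) z.1 ++ z.2.

(* The Bernoulli weight of an approximate square whose fibre law is that of [w]
   and whose column law is [v]. *)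
Definition bern (w : I -> R) (v : column F -> R) z : R :=
  (\prod_(i <- z.1) (w i / colmass F w i * v (eta F i))) * \prod_(l <- z.2) v l.

Lemma eta_vec_emp (u : seq I) : eta_vec (F := F) (emp R u) = emp R (map (eta F) u).
Proof.
apply/funext => l; rewrite /eta_vec /emp -mulr_suml size_map; congr (_ / _).
rewrite -natr_sum; congr _%:R; rewrite count_map.
elim: u => [|j u ih] /=; first by rewrite big1.
rewrite big_split/= ih; congr (_ + _)%N.
have [jl|jl] := eqVneq (eta F j) l.
  rewrite (bigD1 j) ?jl ?eqxx//= big1 ?addn0// => i /andP[_ /negbTE].
  by rewrite eq_sym => ->.
by rewrite big1// => i /eqP il; case: eqP => // ji; rewrite ji il eqxx in jl.
Qed.

Lemma bern_ge0 w v z : (forall i, 0 <= w i) -> (forall l, 0 <= v l) ->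
  0 <= bern w v z.
Proof.
move=> w0 v0; rewrite mulr_ge0// prodr_ge0// => i _.
by rewrite mulr_ge0// divr_ge0// eta_vec_ge0.
Qed.

(** The pairs embed into all pairs of words of lengths [k] and [m], where the weight factorises. The
    fibre factor may sum to less than 1: a column without [w]-mass contributes 0, by the convention
    for division by 0. *)
Lemma sum_bern_le1 w v (s : seq (seq I * seq (column F))) k m :
  (forall i, 0 <= w i) -> simplex v -> uniq s ->
  (forall z, z \in s -> size z.1 = k /\ size z.2 = m) ->
  \sum_(z <- s) bern w v z <= 1.
Proof.
move=> w0 [v0 v1] us sz.
pose t := [seq (u, u') | u <- words I k, u' <- words (column F) m].
apply: (@le_trans _ _ (\sum_(z <- t) bern w v z)).
  apply: ler_sum_uniq_sub => // [z|[u u'] zs]; first exact: bern_ge0.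
  apply/allpairsP; exists (u, u'); have [/= <- <-] := sz _ zs.
  by rewrite !mem_words.
rewrite big_allpairs/= /bern/=.
under eq_bigr do rewrite -mulr_sumr sum_words v1 expr1n mulr1.
rewrite sum_words exprn_ile1//.
  by apply: sumr_ge0 => i _; rewrite mulr_ge0// divr_ge0// eta_vec_ge0.
rewrite (partition_big (eta F) predT)//= -v1; apply: ler_sum => l _.
rewrite (eq_bigr (fun i => w i * (v l / eta_vec w l))); last first.
  by move=> i /eqP <-; rewrite /colmass mulrAC -!mulrA.
rewrite -mulr_suml -/(eta_vec w l) mulrCA.
have [->|wl] := eqVneq (eta_vec w l) 0; first by rewrite mul0r mulr0.
by rewrite divff// mulr1.
Qed.

(** Letters that occur have positive frequency, so all logarithms are genuine. *)
Lemma bern_emp z : (0 < size z.1)%N ->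
  let w := emp R z.1 in let v := emp R (columns_of z) in
  bern w v z = expR ((size z.1)%:R * avg w (ln_fibre F w) +
    (size (columns_of z))%:R * avg v (fun l => ln (v l))).
Proof.
move=> u0 w v; rewrite !avg_emp//; last first.
  by rewrite size_cat size_map ltn_addr.
rewrite expRD !expR_sum [columns_of z in X in _ = _ * X]/columns_of.
rewrite big_cat big_map mulrA -big_split/=.
congr (_ * _); apply: eq_big_seq => i iz; last first.
  by rewrite lnK// posrE; apply: emp_gt0; rewrite mem_cat iz orbT.
have wi : 0 < w i by exact: emp_gt0.
have ci : 0 < colmass F w i by apply: colmass_gt0 => // j; exact: emp_ge0.
rewrite /ln_fibre expRB !lnK ?posrE//.
by apply: emp_gt0; rewrite mem_cat map_f.
Qed.

(** The cap [M] makes the count vectors a finite type; it is later chosen above all lengths, so that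
    [inord] loses nothing. *)
Definition ztype M z : {ffun I -> 'I_M.+1} * {ffun column F -> 'I_M.+1} :=
  ([ffun i => inord (count_mem i z.1)],
   [ffun l => inord (count_mem l (columns_of z))]).

(** Method of types: words of one type share lengths and frequencies, so their [bern] weights refer
    to a single law and sum to at most 1; the decay in [a] pays for the number of types. *)
Lemma sum_square_weights (W : seq I * seq (column F) -> R) (C a : R)
    (s : seq (seq I * seq (column F))) :
  0 <= C -> 0 <= a < 1 -> uniq s ->
  (forall z, z \in s -> (0 < size z.1)%N /\
     W z <= C * a ^+ (size z.1 + size (columns_of z)) *
            bern (emp R z.1) (emp R (columns_of z)) z) ->
  \sum_(z <- s) W z <= C * ((1 - a)^-1 ^+ #|I| * (1 - a)^-1 ^+ #|{: column F}|).
Proof.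
move=> C0 a01 us sW; have a0 : 0 <= a by case/andP: a01.
pose M := \max_(z <- s) size (columns_of z).
have zM z : z \in s -> (size (columns_of z) <= M)%N.
  by move=> zs; rewrite /M (big_rem z)//= leq_maxl.
have c1 z i : z \in s -> nat_of_ord ((ztype M z).1 i) = count_mem i z.1.
  move=> zs; rewrite ffunE inordK// ltnS; apply: leq_trans (zM z zs).
  by rewrite size_cat size_map; apply: leq_trans (count_size _ _) (leq_addr _ _).
have c2 z l : z \in s -> nat_of_ord ((ztype M z).2 l) = count_mem l (columns_of z).
  by move=> zs; rewrite ffunE inordK// ltnS; apply: leq_trans (zM z zs); exact: count_size.
pose T : finType := ({ffun I -> 'I_M.+1} * {ffun column F -> 'I_M.+1})%type.
pose n1 (t : T) := (\sum_i t.1 i)%N; pose n2 (t : T) := (\sum_l t.2 l)%N.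
have n1E z : z \in s -> n1 (ztype M z) = size z.1.
  by move=> zs; rewrite -sum_count_size; apply: eq_bigr => i _; exact: c1.
have n2E z : z \in s -> n2 (ztype M z) = size (columns_of z).
  by move=> zs; rewrite -sum_count_size; apply: eq_bigr => i _; exact: c2.
pose wt (t : T) (i : I) : R := (t.1 i)%:R / (n1 t)%:R.
pose vt (t : T) (l : column F) : R := (t.2 l)%:R / (n2 t)%:R.
have wtE z : z \in s -> emp R z.1 = wt (ztype M z).
  by move=> zs; apply/funext => i; rewrite /wt c1// n1E.
have vtE z : z \in s -> emp R (columns_of z) = vt (ztype M z).
  by move=> zs; apply/funext => i; rewrite /vt c2// n2E.
apply: (@le_trans _ _ (\sum_(z <- s) C * a ^+ (n1 (ztype M z) + n2 (ztype M z)) *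
    bern (wt (ztype M z)) (vt (ztype M z)) z)).
  rewrite !big_seq; apply: ler_sum => z zs.
  by rewrite -wtE// -vtE// n1E// n2E//; case: (sW z zs).
rewrite (partition_big (ztype M) predT)//=.
apply: (@le_trans _ _ (\sum_(t : T) C * a ^+ (n1 t + n2 t))).
  apply: ler_sum => t _.
  rewrite (eq_bigr (fun z => C * a ^+ (n1 t + n2 t) * bern (wt t) (vt t) z)); last first.
    by move=> z /eqP ->.
  rewrite -mulr_sumr ler_piMr ?mulr_ge0 ?exprn_ge0//.
  rewrite -big_filter; case E: [seq z <- s | ztype M z == t] => [|z0 s'].
    by rewrite big_nil.
  have mem z : z \in z0 :: s' -> z \in s /\ ztype M z = t.
    by rewrite -E mem_filter => /andP[/eqP].
  have [z0s z0t] := mem z0 (mem_head _ _).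
  (* [columns_of] begins with the columns of the first word, which are subtracted to get the length
     of the second. *)
  apply: (@sum_bern_le1 _ _ _ (n1 t) (n2 t - n1 t)%N).
  - by move=> i; rewrite -z0t -wtE//; exact: emp_ge0.
  - rewrite -z0t -vtE//; apply: emp_simplex; have [? _] := sW z0 z0s.
    by rewrite size_cat size_map ltn_addr.
  - by rewrite -E filter_uniq.
  move=> z /mem[zs <-]; rewrite n1E// n2E// size_cat size_map.
  by rewrite addKn.
rewrite -mulr_sumr; apply: ler_wpM2l => //.
rewrite -(pair_bigA _ (fun (x : {ffun I -> 'I_M.+1}) (y : {ffun column F -> 'I_M.+1}) =>
  a ^+ ((\sum_i x i)%N + (\sum_l y l)%N)))/=.
under eq_bigr => x _.
  under eq_bigr do rewrite exprD.
  rewrite -mulr_sumr; over.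
rewrite -mulr_suml; apply: ler_pM.
- by apply: sumr_ge0 => x _; exact: exprn_ge0.
- by apply: sumr_ge0 => x _; exact: exprn_ge0.
- exact: sum_types_le.
- exact: sum_types_le.
Qed.

End Bernoulli.

Lemma birkhoff_mkseq (R : realType) (I : finType) (f : I -> R) s k :
  birkhoff f s k = \sum_(i <- mkseq s k) f i.
Proof.
by rewrite /birkhoff big_map -[k in iota _ k]subn0 -/(index_iota 0 k) big_mkord.
Qed.

(** * Rates of fibres and columns *)

Section UpperRates.
Variables (R : realType) (I : finType) (F : ifs R I).
Variables (p : I -> R) (q : R).
Hypothesis hF : gatzouras_lalley F.

Definition lamc (l : column F) : R := - ln (col_beta1 l).

Lemma lamc_eta i : lamc (eta F i) = lam1 F i.
Proof. by rewrite /lamc col_beta1_eta. Qed.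

Lemma lamc_gt0 l : 0 < lamc l.
Proof. by rewrite -(etaK l) lamc_eta; exact: lam1_gt0. Qed.

Definition col_rate (v : column F -> R) : R :=
  (q * avg v (fun l => ln (eta_vec p l)) - avg v (fun l => ln (v l))) / avg v lamc.

Definition fibre_rate (w : I -> R) : R :=
  (q * avg w (ln_fibre F p) - avg w (ln_fibre F w)) / avg w (lam2 F).

(** The column rate sees only a column vector, so it can also be evaluated at the column frequencies
    of a longer word. *)
Lemma objective_rates w : (forall i, 0 <= w i) ->
  - objective F p q w = fibre_rate w + col_rate (eta_vec w).
Proof.
move=> w0; rewrite objectiveE// /fibre_rate /col_rate !avg_eta /ln_fibre !avgB.
have -> : avg w (fun i => lamc (eta F i)) = avg w (lam1 F).
  by apply: eq_bigr => i _; rewrite lamc_eta.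
rewrite /colmass; ring.
Qed.

(** The denominator is at least the smallest [lamc], and [ln (1 / x) <= 1 / x - 1] bounds [|x ln x|]
    by 1 on the unit interval. *)
Lemma col_rate_bounded : exists2 B : R, 0 <= B &
  forall v, simplex v -> `|col_rate v| <= B.
Proof.
have [M M0 MP] := finite_upper_bound (fun l : column F => ln (eta_vec p l)).
have [l l0 ll] := finite_lower_bound lamc_gt0.
exists ((`|q| * M + #|{: column F}|%:R) / l).
  by rewrite divr_ge0 ?(ltW l0)// addr_ge0 ?ler0n// mulr_ge0 ?(ltW M0).
move=> v vs; have [v0 v1] := vs.
have la : l <= avg v lamc by rewrite -[l](avg_cst _ v1); exact: le_avg.
have lv0 : 0 < avg v lamc by exact: lt_le_trans la.
rewrite normrM normfV (gtr0_norm lv0); apply: ler_pM => //.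
- by rewrite invr_ge0 ltW.
- apply: le_trans (ler_normB _ _) _; apply: lerD.
    rewrite normrM ler_wpM2l// ler_norml -(avg_cst M v1) -mulN1r -avgZ.
    by apply/andP; split; apply: le_avg => // i _; have := MP i; rewrite ler_norml;
       move=> /andP[? ?]; lra.
  apply: le_trans (ler_norm_sum _ _ _) _.
  rewrite -sum1_card natr_sum; apply: ler_sum => i _.
  have vi1 := simplex_le1 i vs.
  have [->|vi] := eqVneq (v i) 0; first by rewrite mul0r normr0 ler01.
  have vi0 : 0 < v i by rewrite lt_def vi v0.
  rewrite normrM (ger0_norm (v0 i)) ler0_norm ?ln_le0//.
  rewrite -lnV ?posrE//; apply: (@le_trans _ _ (v i * ((v i)^-1 - 1))).
    by rewrite ler_wpM2l// ln_le_subr1// invr_gt0.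
  by rewrite mulrBr divff// mulr1; have := v0 i; lra.
- by rewrite lef_pV2 ?posrE.
Qed.

(* [expR (q ln mu (B) + t ln r)], up to a constant, for the ball [B] of radius
   [r] around the approximate square [z]. *)
Definition square_weight (t : R) (z : seq I * seq (column F)) : R :=
  expR (q * (\sum_(i <- z.1) ln_fibre F p i + \sum_(l <- columns_of z) ln (eta_vec p l))
        - t * \sum_(i <- z.1) lam2 F i).

(** The last two clauses say that width and height agree up to the factor [expR A]; the second is
    the comparison of column rates between the two lengths. *)
Definition good_square (e A : R) (z : seq I * seq (column F)) : Prop :=
  [/\ (0 < size z.1)%N,
      col_rate (emp R (columns_of z)) <= col_rate (emp R (map (eta F) z.1)) + e,
      \sum_(i <- z.1) lam2 F i <= \sum_(l <- columns_of z) lamc l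
    & \sum_(l <- columns_of z) lamc l <= \sum_(i <- z.1) lam2 F i + A].

(** In terms of rates the weight is [bern] at its own frequencies times an exponential in which
    [fibre_rate w + col_rate v] is at most [- m + e]. Against the gauge [- m + 2 * e] this leaves a
    decay [expR (- e * psi2)], up to constants. *)
Lemma square_weight_le (m e A : R) : 0 < e -> 0 <= A ->
  (forall w, simplex w -> m <= objective F p q w) ->
  exists C a : R, [/\ 0 <= C, 0 <= a < 1 & forall z, good_square e A z ->
    square_weight (- m + 2 * e) z <=
      C * a ^+ (size z.1 + size (columns_of z)) *
      bern (emp R z.1) (emp R (columns_of z)) z].
Proof.
move=> e0 A0 mP; have [B B0 BP] := col_rate_bounded.
have [l l0 ll] := finite_lower_bound (lam1_gt0 hF).
(* [A * B] pays for unequal width and height; the rest converts [psi2] into lengths by [l * (k + n)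
   <= psi1 + psi2 <= 2 * psi2 + A]. *)
exists (expR (A * B + e * A / 2)), (expR (- (e * l / 2))); split.
- exact: expR_ge0.
- by rewrite expR_ge0/= -[ltRHS]expR0 ltr_expR oppr_lt0 divr_gt0// mulr_gt0.
move=> z [u0 rate psi12 psi21].
set w := emp R z.1; set v := emp R (columns_of z).
set k := size z.1; set n := size (columns_of z).
have n0 : (0 < n)%N by rewrite /n size_cat size_map ltn_addr.
have ws : simplex w := emp_simplex R u0; have vs : simplex v := emp_simplex R n0.
rewrite bern_emp// -/w -/v -/k -/n -expRM_natl -!expRD ler_expR.
rewrite -(avg_emp (ln_fibre F p) u0) -/w -/k.
rewrite -(avg_emp (fun l => ln (eta_vec p l)) n0) -/v -/n.
rewrite -(avg_emp (lam2 F) u0) -/w -/k.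
move: psi12 psi21; rewrite -(avg_emp (lam2 F) u0) -(avg_emp lamc n0) -/w -/v -/k -/n.
have l20 : 0 < avg w (lam2 F) := avg_gt0 ws (lam2_gt0 hF).
have lc0 : 0 < avg v lamc := avg_gt0 vs lamc_gt0.
have frE : q * avg w (ln_fibre F p) = avg w (ln_fibre F w) + fibre_rate w * avg w (lam2 F).
  by rewrite /fibre_rate divfK ?gt_eqF//; ring.
have crE : q * avg v (fun l => ln (eta_vec p l)) =
    avg v (fun l => ln (v l)) + col_rate v * avg v lamc.
  by rewrite /col_rate divfK ?gt_eqF//; ring.
have kl : k%:R * l <= k%:R * avg w (lam2 F).
  rewrite ler_wpM2l ?ler0n// -[leLHS](avg_cst _ ws.2); apply: le_avg; first exact: ws.1.
  by move=> i _; apply: (le_trans (ll i)); rewrite ltW// lam12.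
have nl : n%:R * l <= n%:R * avg v lamc.
  rewrite ler_wpM2l ?ler0n// -[leLHS](avg_cst _ vs.2); apply: le_avg; first exact: vs.1.
  by move=> i _; rewrite -(etaK i) lamc_eta.
have obj := mP w ws; have := objective_rates ws.1; rewrite eta_vec_emp -/w => objE.
move: rate objE; rewrite -/v; set r0 := col_rate (emp _ _) => rate objE.
have := BP v vs; rewrite ler_norml => /andP[_ cB].
rewrite mulrDr [q * (k%:R * _)]mulrCA [q * (n%:R * _)]mulrCA frE crE.
set psi2 := k%:R * avg w (lam2 F); set psi1 := n%:R * avg v lamc => psi12 psi21.
rewrite -/psi2 in kl *; rewrite -/psi1 in nl.
set hw := avg w (ln_fibre F w); set hv := avg v _.
have -> : k%:R * (hw + fibre_rate w * avg w (lam2 F)) +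
    n%:R * (hv + col_rate v * avg v lamc) - (- m + 2 * e) * psi2 =
    (k%:R * hw + n%:R * hv) + (psi2 * (fibre_rate w + col_rate v + m - 2 * e) +
      (psi1 - psi2) * col_rate v).
  by rewrite /psi1 /psi2; ring.
have psi20 : 0 <= psi2 by rewrite mulr_ge0 ?ler0n// ltW.
have h1 : psi2 * (fibre_rate w + col_rate v + m - 2 * e) <= psi2 * (- e).
  by apply: ler_wpM2l => //; lra.
have h2 : (psi1 - psi2) * col_rate v <= A * B.
  apply: (@le_trans _ _ ((psi1 - psi2) * B)).
    by apply: ler_wpM2l => //; rewrite subr_ge0.
  by apply: ler_wpM2r => //; lra.
have h3 : e * ((k%:R + n%:R) * l) <= e * (2 * psi2 + A).
  by apply: ler_wpM2l; [exact: ltW|lra].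
rewrite natrD; lra.
Qed.

End UpperRates.

(** * Scales with controlled column rate *)

Section GoodScale.
Variables (R : realType) (I : finType) (F : ifs R I).
Variables (p : I -> R) (q : R).
Hypothesis hF : gatzouras_lalley F.

Definition square_word (s : nat -> I) (k n : nat) : seq I * seq (column F) :=
  (mkseq s k, mkseq (fun j => eta F (s (k + j)%N)) (n - k)).

Lemma columns_square_word s k n : (k <= n)%N ->
  columns_of (square_word s k n) = map (eta F) (mkseq s n).
Proof.
move=> kn; rewrite /columns_of/= -{2}(subnKC kn) /mkseq iotaD map_cat map_cat.
have -> : iota (0 + k) (n - k) = map (addn k) (iota 0 (n - k)).
  by rewrite -iotaDl addn0.
by rewrite -!map_comp.
Qed.

(** The level [n] is the first at which the width is at most the height at level [k]; the overshoot
    is one symbol. *)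
Lemma next_scale : exists2 A : R, 0 <= A & forall s k, (0 < k)%N ->
  exists n, [/\ (k <= n)%N, birkhoff (lam2 F) s k <= birkhoff (lam1 F) s n
    & birkhoff (lam1 F) s n <= birkhoff (lam2 F) s k + A].
Proof.
have [A A0 AP] := finite_upper_bound (lam1 F).
exists A => [|s k k0]; first exact: ltW.
have t0 : 0 < birkhoff (lam2 F) s k.
  case: k k0 => // k _; rewrite birkhoffSl ltr_pwDl ?lam2_gt0//.
  by apply: sumr_ge0 => j _; rewrite ltW ?lam2_gt0.
have [n /andP[n1 n2]] := stopping (lam1_gt0 hF) s t0.
exists n.+1; split=> //.
  rewrite leqNgt; apply/negP => nk.
  have := le_birkhoff (lam2_gt0 hF) s (ltnW nk).
  have : birkhoff (lam1 F) s n.+1 < birkhoff (lam2 F) s n.+1.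
    rewrite !birkhoffSr; have := lam12 hF (s n); have := birkhoff_lam12 hF s n.
    lra.
  lra.
by rewrite birkhoffSr; have := AP (s n); rewrite ler_norml => /andP[? ?]; lra.
Qed.

(* The column rates at the scales k, n(k), n(n(k)), ... are bounded, so they
   cannot increase by [e] at every step. *)
Lemma good_scale (e : R) : 0 < e -> exists2 A : R, 0 <= A &
  forall s K, exists k n, [/\ (K <= k)%N, (k <= n)%N &
    good_square p q e A (square_word s k n)].
Proof.
move=> e0; have [A A0 AP] := next_scale; exists A => // s K.
have [B B0 BP] := col_rate_bounded p q hF.
pose rate k := col_rate p q (emp R (map (eta F) (mkseq s k))).
have rB k : (0 < k)%N -> `|rate k| <= B.
  by move=> k0; apply: BP; apply: emp_simplex; rewrite size_map size_mkseq.
have /choice[nx nxP] : forall k, exists n, (0 < k)%N -> [/\ (k <= n)%N,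
    birkhoff (lam2 F) s k <= birkhoff (lam1 F) s n
    & birkhoff (lam1 F) s n <= birkhoff (lam2 F) s k + A].
  by move=> [|k]; [exists 0%N|have [n nP] := AP s k.+1 isT; exists n].
apply: contrapT => bad.
have step k : (K <= k)%N -> (0 < k)%N -> rate k + e < rate (nx k).
  move=> Kk k0; have [kn h1 h2] := nxP k k0.
  rewrite ltNge; apply/negP => rk; apply: bad; exists k, (nx k); split=> //.
  have lE : \sum_(l <- columns_of (square_word s k (nx k))) lamc l =
      birkhoff (lam1 F) s (nx k).
    rewrite columns_square_word// big_map birkhoff_mkseq.
    by apply: eq_bigr => i _; rewrite lamc_eta.
  split; rewrite ?lE/= -?birkhoff_mkseq//.
    by rewrite size_mkseq.
  by rewrite columns_square_word.
(* Starting at [K.+1] keeps all levels positive, so that the frequencies are probability vectors. *)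
pose kk j := iter j nx K.+1.
have kkP j : (K < kk j)%N.
  elim: j => //= j ih; have [h _ _] := nxP (kk j) (leq_ltn_trans (leq0n _) ih).
  exact: leq_trans h.
have grow j : rate (kk 0%N) + e * j%:R <= rate (kk j).
  elim: j => [|j ih]; first by rewrite mulr0 addr0.
  have := step (kk j) (ltnW (kkP j)) (leq_ltn_trans (leq0n _) (kkP j)).
  by rewrite -/(kk j.+1) -natr1 mulrDr mulr1; lra.
pose N := Num.bound (2 * B / e).
have := grow N; have := rB (kk N) (leq_ltn_trans (leq0n _) (kkP N)).
have := rB (kk 0%N) isT; rewrite !ler_norml => /andP[? ?] /andP[? ?].
have : 2 * B < e * N%:R.
  rewrite [ltRHS]mulrC -ltr_pdivrMr//; apply: archi_boundP.
  by rewrite divr_ge0 ?mulr_ge0// ltW.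
lra.
Qed.

End GoodScale.

(** * The cover by approximate squares *)

Section UpperBound.
Variables (R : realType) (I : finType) (F : ifs R I) (L : set (R * R)).
Variables (p : I -> R) (mu : probability (R * R)%type R) (q : R).
Hypothesis hF : gatzouras_lalley F.
Hypothesis hL : attractor F L.
Hypothesis hsep : separated_principal_projections F L.
Hypothesis hp : simplex p.
Hypothesis p0 : forall i, 0 < p i.
Hypothesis hmu : self_affine F p mu.
Variables (c : R * R -> nat -> I) (hc : coding F L c).

Lemma square_word_agree x y k n k' n' : (k <= n)%N -> (k' <= n')%N ->
  square_word F (c x) k n = square_word F (c y) k' n' ->
  [/\ k = k', n = n', forall j, (j < k)%N -> c x j = c y j &
      forall j, (j < n)%N -> eta F (c x j) = eta F (c y j)].
Proof.
move=> kn kn' xy; have kk : k = k'.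
  by move: xy => [/(congr1 size)]; rewrite !size_mkseq.
subst k'; have nn : n = n'.
  have := congr1 (fun z => size z.2) xy; rewrite /= !size_mkseq.
  by move=> nn; rewrite -(subnKC kn) nn subnKC.
subst n'; split=> // j jk.
  have := congr1 (fun z => nth (c x 0) z.1 j) xy.
  by rewrite /= !nth_mkseq.
have := congr1 (fun z => nth (eta F (c x 0)) (columns_of z) j) xy.
by rewrite /= !columns_square_word// !(nth_map (c x 0)) ?size_mkseq// !nth_mkseq.
Qed.

(** Every point of [E] has a good square of level at least [K]. With one disc per square word,
    centred at a point of [E] having that word, [sum_square_weights] bounds the total independently
    of [E] and [d]. *)
Lemma Hmeas_upper (m t : R) : (forall w, simplex w -> m <= objective F p q w) ->
  - m < t -> (Hmeas mu q t L < +oo)%E.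
Proof.
move=> mP mt; pose e := (t + m) / 2.
have e0 : 0 < e by rewrite divr_gt0//; lra.
have [A A0 goodP] := good_scale p q hF e0.
have [C [a [C0 a01 weightP]]] := square_weight_le hF e0 A0 mP.
have [D D0 hD] := attractor_bounded hL.
pose lD := ln (2 * D).
have D20 : 0 < 2 * D by rewrite mulr_gt0.
have [M [r0 [r00 massP]]] := cball_mass hF hL hsep hp p0 hmu hc (`|lD| + A).
have [rr rr0 posP] := cball_mass_gt0 hF hL hp p0 hmu hc.
have [l l0 ll] := finite_lower_bound (lam2_gt0 hF).
pose T := expR (`|q| * `|M| + t * lD) *
  (C * ((1 - a)^-1 ^+ #|I| * (1 - a)^-1 ^+ #|{: column F}|)).
apply: (@le_lt_trans _ _ T%:E); last exact: ltry.
apply: ge_ereal_sup => _ [E [d [EL d0 ->]]].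
pose d' := Num.min d (Num.min (r0 / 2) (rr / 2)).
have d'0 : 0 < d' by rewrite !lt_min d0 !divr_gt0.
have d'd : d' <= d by rewrite ge_min lexx.
have d'r0 : d' <= r0 / 2 by rewrite !ge_min lexx !orbT.
have d'rr : d' <= rr / 2 by rewrite !ge_min lexx !orbT.
(* From level [K] on, the radii are at most [d']. *)
pose K := Num.bound `|(lD - ln d') / l|.
(* The radius is [2 * D] times the height of the rectangle. *)
pose rad (z : seq I * seq (column F)) := expR (lD - \sum_(i <- z.1) lam2 F i).
pose rep z x := E x /\ exists k n, [/\ (K <= k)%N, (k <= n)%N,
  good_square p q e A (square_word F (c x) k n) & z = square_word F (c x) k n].
have rad_le z x : rep z x -> rad z <= d'.
  move=> [_ [k [n [Kk kn _ ->]]]]; rewrite /rad/= -birkhoff_mkseq.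
  rewrite -[leRHS](lnK (x := d')) ?posrE// ler_expR lerBlDl -lerBlDr.
  have : lD - ln d' <= l * K%:R.
    rewrite [leRHS]mulrC -ler_pdivrMr//; apply: le_trans (ler_norm _) _.
    by apply: ltW; apply: archi_boundP.
  move=> /le_trans; apply; apply: (@le_trans _ _ (l * k%:R)).
    by rewrite ler_pM2l// ler_nat.
  rewrite -[k in k%:R]card_ord -sum1_card natr_sum mulr_sumr.
  by apply: ler_sum => j _; rewrite mulr1.
pose Dn := [set j : nat | exists z x, pickle z = j /\ rep z x].
have /choice[f fP] : forall j, exists zx : (seq I * seq (column F)) * (R * R),
    Dn j -> pickle zx.1 = j /\ rep zx.1 zx.2.
  move=> j; have [[z [x zx]]|nD] := pselect (Dn j); first by exists (z, x).
  by exists (([::], [::]), (0, 0)).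
pose Z j := (f j).1; pose X j := (f j).2.
apply: (@le_trans _ _ (\esum_(j in Dn)
    (fine (mu (cball (X j) (rad (Z j)))) `^ q * rad (Z j) `^ t)%:E)%E).
  apply: ereal_inf_lbound; exists Dn, X, (fun j => rad (Z j)); split=> //; split.
    move=> j /fP[_ zx]; split; first by case: zx.
    by rewrite expR_gt0 (le_trans (rad_le _ _ zx)).
  move=> y Ey; have [k [n [Kk kn good]]] := goodP (c y) K.
  pose z := square_word F (c y) k n.
  have Dz : Dn (pickle z).
    by exists z, y; split=> //; split=> //; exists k, n.
  exists (pickle z) => //.
  (* Injectivity of [pickle] identifies the chosen word with that of [y]; the centre may be another
     point, but it lies in the same square. *)
  have [/(pcan_inj pickleK) zE [Ex [k' [n' [_ kn' _ zE']]]]] := fP _ Dz.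
  rewrite -/(Z _) -/(X _) in zE zE' Ex *.
  have [kk nn ag1 ag2] := square_word_agree kn' kn (etrans (esym zE') zE).
  subst k' n'; have [u0 _ psi12 _] := good.
  have LX := EL _ Ex.
  apply: (square_sub_cball hF hL hc hD D0 (expR_gt0 _) kn LX).
  - rewrite zE expRK /z/= opprB addrC subrK birkhoff_mkseq le_eqVlt.
    apply/orP; left; apply/eqP; rewrite -!birkhoff_mkseq.
    by apply: eq_bigr => j _; rewrite ag1.
  - rewrite zE expRK /z/= opprB addrC subrK.
    apply: le_trans psi12 _; rewrite columns_square_word// big_map.
    rewrite (eq_bigr (lam1 F)) => [|i _]; last by rewrite lamc_eta.
    rewrite -birkhoff_mkseq le_eqVlt; apply/orP; left; apply/eqP.
    by apply: eq_bigr => j _; rewrite -!lamc_eta ag2.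
  by apply: square_cylinder; first exact: EL.
(* The sum over [Dn] is a supremum over its finite subsets [J]. *)
apply: ge_ereal_sup => _ [J [fJ JD] <-].
rewrite fsbig_finite//= sumEFin lee_fin.
set js := finmap.enum_fset (fset_set J).
have JDn j : j \in js -> Dn j.
  by move=> jJ; have := in_fset_set fJ j; rewrite [X in X = _]jJ => /esym/set_mem/JD.
(* Passing from the disc mass to the square mass costs [expR (|q| * |M|)] for either sign of [q];
   [expR (t * lD)] comes from the factor [2 * D] in the radius. *)
apply: (@le_trans _ _ (\sum_(j <- js)
    expR (`|q| * `|M| + t * lD) * square_weight p q t (Z j))).
  rewrite big_seq [leRHS]big_seq; apply: ler_sum => j /JDn/fP[_].
  rewrite -/(Z j) -/(X j) => zx; have := rad_le _ _ zx.
  move: zx => [Ex [k [n [Kk kn good ->]]]] radd'.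
  set z := square_word _ _ _ _ in good radd' *.
  have [u0 _ psi12 psi21] := good.
  have LX := EL _ Ex.
  have radr : 0 < rad z < r0 by rewrite expR_gt0/=; lra.
  have radrr : 0 < rad z < rr by rewrite expR_gt0/=; lra.
  have m0 := posP _ _ LX radrr.
  have lrad : ln (rad z) = lD - birkhoff (lam2 F) (c (X j)) k.
    by rewrite expRK birkhoff_mkseq.
  have b1 : \sum_(l <- columns_of z) lamc l = birkhoff (lam1 F) (c (X j)) n.
    rewrite columns_square_word// big_map birkhoff_mkseq.
    by apply: eq_bigr => i _; rewrite lamc_eta.
  have b2 : \sum_(i <- z.1) lam2 F i = birkhoff (lam2 F) (c (X j)) k.
    by rewrite birkhoff_mkseq.
  rewrite b1 b2 in psi12 psi21.
  have sc : at_scale F (`|lD| + A) (c (X j)) (rad z) k n.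
    have := ler_norm lD; have := ler_norm (- lD); rewrite normrN => hp2 hp1.
    split=> //; rewrite lrad ler_norml; clear -psi12 psi21 A0 hp1 hp2.
      by apply/andP; split; lra.
    by apply/andP; split; lra.
  have := massP _ _ _ _ LX radr sc.
  rewrite /powR !gt_eqF ?expR_gt0// -expRD /square_weight -expRD ler_expR lrad b2.
  have -> : \sum_(l <- columns_of z) ln (eta_vec p l) = birkhoff (ln_col F p) (c (X j)) n.
    by rewrite columns_square_word// big_map birkhoff_mkseq.
  rewrite -birkhoff_mkseq; set S := _ + birkhoff _ _ n; set lm := ln (fine _) => hM.
  have : q * (lm - S) <= `|q| * `|M|.
    apply: le_trans (ler_norm _) _; rewrite normrM ler_wpM2l//.
    by apply: le_trans hM _; exact: ler_norm.
  rewrite mulrBr; lra.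
rewrite -mulr_sumr ler_wpM2l ?expR_ge0//.
rewrite -(big_map Z xpredT (square_weight p q t)).
apply: sum_square_weights => //.
  rewrite map_inj_in_uniq ?finmap.fset_uniq// => j j' /JDn/fP[h _] /JDn/fP[h' _].
  by rewrite /Z => zz; rewrite -h zz h'.
move=> z /mapP[j /JDn/fP[_ [_ [k [n [_ kn good zE]]]]] zj].
rewrite -/(Z j) -zj in zE; subst z; rewrite zE; split.
  by case: good.
have := weightP _ good; have -> // : - m + 2 * e = t by rewrite /e; field.
Qed.

End UpperBound.

Theorem theoremA (R : realType) (I : finType) (F : ifs R I)
    (L : set (R * R)) (p : I -> R) (mu : probability (R * R)%type R) (q : R)
    (hF : gatzouras_lalley F)
    (hL : attractor F L)
    (hsep : separated_principal_projections F L)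
    (hp : simplex p) (hp0 : forall i, 0 < p i)
    (hmu : self_affine F p mu) :
  exists m : R,
    [/\ fine_spectrum mu q = m%:E,
        is_minimum
          [set q * udim F p w - vdim F w | w in @simplex R I] m
      & is_minimum
          [set (q * cross_entropy v (eta_vec p) - entropy v) / chi1 v
               + fibred_spectrum p v q | v in @simplex R (column F)] m].
Proof.
have [c hc] := coding_ex hF hsep.
have [w ws wmin] := objective_min hF p q.
pose m := objective F p q w.
have mmin : is_minimum [set objective F p q w | w in @simplex R I] m.
  by split; [exists w|move=> _ [w' w's <-]; exact: wmin].
exists m; split => //; last exact: fibred_min.
rewrite /fine_spectrum (supp_attractor hF hL hp hp0 hmu hc).
suff -> : b_exp mu L q = (- m)%:E by rewrite -EFinN opprK.
(* Exponents above [- m] are admissible by [Hmeas_upper]; those below are excluded by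
   [Hmeas_lower]. *)
apply/eqP; rewrite eq_le; apply/andP; split.
  apply/lee_addgt0Pr => e e0; apply: ereal_inf_lbound.
  exists (- m + e) => //=.
  by apply: (Hmeas_upper hF hL hsep hp hp0 hmu hc wmin); rewrite ltrDl.
apply: le_ereal_inf_tmp => _ [t tfin <-]; rewrite lee_fin leNgt; apply/negP => tm.
exact: (Hmeas_lower hF hL hsep hp hp0 hmu hc ws tm).
Qed.
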